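(* Let $\Theta\subset\mathbb{R}^n$ be a symmetric set, $C=\{X\in\mathbf{S}^n:\lambda(X)\in\Theta\}$, $X\in C$ and $H\in T_C(X)$. Then $$T^2_C(X,H)=\{W\in\mathbf{S}^n:\ \lambda''(X;H,W)\in T^2_\Theta\big(\lambda(X),\lambda'(X;H)\big)\}.$$ Moreover: (a) if $\Theta$ is parabolically derivable at $\lambda(X)$ for $\lambda'(X;H)$, then $C$ is parabolically derivable at $X$ for $H$; (b) if $C$ is parabolically derivable at $X$ for every $H\in T_C(X)$, then $\Theta$ is parabolically derivable at $\lambda(X)$ for every $v\in T_\Theta(\lambda(X))$.
   Context: $\mathbf{S}^n$: real symmetric matrices; $\lambda(X)$: eigenvalues in nonincreasing order; $\Theta$ symmetric: invariant under coordinate permutations. Tangent cone $T_C(\bar x)=\{w:\exists t_k\downarrow0,w_k\to w,\bar x+t_kw_k\in C\}$; second-order tangent set $T^2_C(\bar x,w)=\{u:\exists t_k\downarrow0,u_k\to u,\ \bar x+t_kw+\tfrac12t_k^2u_k\in C\}$. $C$ is parabolically derivable at $\bar x$ for $w\in T_C(\bar x)$ if $T^2_C(\bar x,w)\ne\emptyset$ and for each $u\in T^2_C(\bar x,w)$ there are $\varepsilon>0$ and $\xi:[0,\varepsilon]\to C$ with $\xi(0)=\bar x$, $\xi'_+(0)=w$, $\xi''_+(0)=u$, where $\xi'_+(0)=\lim_{t\downarrow0}(\xi(t)-\xi(0))/t$ and $\xi''_+(0)=\lim_{t\downarrow0}(\xi(t)-\xi(0)-t\xi'_+(0))/(\frac12t^2)$.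 $\lambda'(X;H)=\lim_{t\downarrow0}(\lambda(X+tH)-\lambda(X))/t$ and $\lambda''(X;H,W)=\lim_{t\downarrow0}\frac{\lambda(X+tH+\frac12t^2W)-\lambda(X)-t\lambda'(X;H)}{\frac12t^2}$ (both exist). *)

(* Defs.v *)
From HB Require Import structures.
From mathcomp Require Import all_boot all_order all_fingroup all_algebra.
From mathcomp Require Import all_classical all_reals all_analysis.
Set Implicit Arguments. Unset Strict Implicit. Unset Printing Implicit Defensive.
Import Order.TTheory GRing.Theory Num.Theory.
Import numFieldNormedType.Exports.
Local Open Scope classical_set_scope.
Local Open Scope ring_scope.

Section Defs.
Variable R : realType.

Section Cones.
Variable V : normedModType R.

Definition tangent_cone (C : set V) (x : V) : set V :=
  [set w | exists (t : nat -> R) (wk : nat -> V),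
     [/\ (forall k, 0 < t k), t @ \oo --> (0 : R), wk @ \oo --> w &
         forall k, C (x + t k *: wk k)]].

Definition second_tangent_set (C : set V) (x w : V) : set V :=
  [set u | exists (t : nat -> R) (uk : nat -> V),
     [/\ (forall k, 0 < t k), t @ \oo --> (0 : R), uk @ \oo --> u &
         forall k, C (x + t k *: w + (2^-1 * t k ^+ 2) *: uk k)]].

(* parabolic derivability of C at x for w (w is assumed in T_C(x) by the callers) *)
Definition parabolically_derivable (C : set V) (x w : V) : Prop :=
  second_tangent_set C x w !=set0 /\
  forall u, second_tangent_set C x w u ->
    exists (eps : R) (xi : R -> V),
      [/\ 0 < eps, (forall t, 0 <= t <= eps -> C (xi t)), xi 0 = x,
          (fun t => t^-1 *: (xi t - xi 0)) @ 0^'+ --> w &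
          (fun t => (2^-1 * t ^+ 2)^-1 *: (xi t - xi 0 - t *: w)) @ 0^'+ --> u].
End Cones.

Variable n : nat.

Definition is_sym_mx (X : 'M[R]_n) : Prop := X^T = X.

Definition perm_symmetric (Theta : set 'rV[R]_n) : Prop :=
  forall (s : 'S_n) (v : 'rV[R]_n), Theta v -> Theta (col_perm s v).

Definition is_eigval_vector (X : 'M[R]_n) (v : 'rV[R]_n) : Prop :=
  (forall i j : 'I_n, (i <= j)%N -> v 0 j <= v 0 i) /\
  char_poly X = \prod_(i < n) ('X - (v 0 i)%:P).

(* lambda(X) : eigenvalues in nonincreasing order (well defined for is_sym_mx X) *)
Definition eigval (X : 'M[R]_n) : 'rV[R]_n := xget 0 (is_eigval_vector X).

Definition eigval_d1 (X H : 'M[R]_n) : 'rV[R]_n :=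
  lim ((fun t : R => t^-1 *: (eigval (X + t *: H) - eigval X)) @ 0^'+).

Definition eigval_d2 (X H W : 'M[R]_n) : 'rV[R]_n :=
  lim ((fun t : R => (2^-1 * t ^+ 2)^-1 *:
          (eigval (X + t *: H + (2^-1 * t ^+ 2) *: W) - eigval X
           - t *: eigval_d1 X H)) @ 0^'+).

Definition spectral_set (Theta : set 'rV[R]_n) : set 'M[R]_n :=
  [set X | is_sym_mx X /\ Theta (eigval X)].
End Defs.

(* Main.v *)
(* Orthogonal conjugations (exact diagonalizations, and Cayley transforms of
   t S + t^2 S' with S, S' skew and chosen so that their commutators with the
   lower-order terms cancel the off-block entries) turn X + tH + t^2 W into
   diag (x + t d + t^2 e) + O(t^3).  Since the eigenvalue map is Lipschitz (Weyl)
   and one fixed permutation sorts x + t d + t^2 e for all small t > 0,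
   lambda (X + tH + t^2 W) = a + t b + t^2 c + O(t^3), so lambda' and lambda'' exist.
   Points of C are moved to Theta by lambda, and points z of Theta to C by
   replacing the eigenvalues of X + tH + t^2 W / 2 by z in an orthonormal
   eigenbasis, which displaces the matrix by at most a constant times the
   displacement of the eigenvalues: this gives the formula, and, applied to arcs,
   (a); nonemptiness of second-order tangent sets comes from Bolzano-Weierstrass.
   For (b), take H = V diag(v) V^T with V an eigenbasis of X; the spectrum of X + tH
   is then explicit and can be un-sorted by a permutation depending on t. *)
Require Import Defs.
From HB Require Import structures.
From mathcomp Require Import all_boot all_order all_fingroup all_algebra.
From mathcomp Require Import all_classical all_reals all_analysis.
From mathcomp Require Import ring lra.
Set Implicit Arguments. Unset Strict Implicit. Unset Printing Implicit Defensive.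
Import Order.TTheory GRing.Theory Num.Theory.
Import numFieldNormedType.Exports.
Local Open Scope classical_set_scope.
Local Open Scope ring_scope.

(** * Cayley transforms and matrix norms *)

(* Matrix products are treated as atoms. *)
Ltac mx_lin :=
  repeat match goal with |- context [?A *m ?B] =>
    let M := fresh "M" in set M := A *m B; clearbody M end;
  let i := fresh "i" in let j := fresh "j" in
  apply/matrixP => i j; rewrite !mxE;
  repeat match goal with |- context [(?a == ?b)%:R] =>
    move: (a == b)%:R => ? end; first [ring | lra].

Section Cayley.
Variables (R : realType) (n : nat).
Implicit Types S Z U : 'M[R]_n.

Definition orthogonal_mx U := U^T *m U = 1%:M.

Definition skew_mx S := S^T = - S.

Lemma mul_trmx_eq0 (v : 'rV[R]_n) : v *m v^T = 0 -> v = 0.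
Proof.
move=> /matrixP/(_ 0 0); rewrite mxE [RHS]mxE => vv0.
apply/rowP => i; rewrite mxE; apply/eqP.
have h j : true -> 0 <= v 0 j * v^T j 0 by rewrite mxE -expr2 sqr_ge0.
by have := psumr_eq0P h vv0 (i := i) isT; rewrite mxE => /eqP; rewrite mulf_eq0 orbb.
Qed.

(** A vector [v] in the left kernel satisfies [v = v S / 2], so [v v^T] is half of [v S v^T], a 1 by
    1 skew matrix, hence 0. *)
Lemma skew_unit S : skew_mx S -> 1%:M - 2^-1 *: S \in unitmx.
Proof.
move=> skS; rewrite unitmxE unitfE; apply/negP => /det0P[v vn0].
rewrite mulmxBr mulmx1 -scalemxAr => /eqP; rewrite subr_eq0 => /eqP vS.
move/eqP: vn0; apply; apply: mul_trmx_eq0.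
have vSv : v *m S *m v^T = 0.
  have : (v *m S *m v^T)^T = - (v *m S *m v^T).
    by rewrite !trmx_mul trmxK skS mulNmx mulmxN mulmxA.
  move: (v *m S *m v^T) => M /matrixP h; apply/matrixP => i j; have := h i j.
  by rewrite !ord1 !mxE => ?; lra.
by rewrite {1}vS -scalemxAl vSv scaler0.
Qed.

(** The factor [2^-1] makes this rational orthogonal map agree with the exponential of [S] up to
    second order. *)
Definition cayley S := invmx (1%:M - 2^-1 *: S) *m (1%:M + 2^-1 *: S).

Lemma cayleyP S : skew_mx S ->
  (1%:M - 2^-1 *: S) *m cayley S = 1%:M + 2^-1 *: S.
Proof. by move=> /skew_unit skS; rewrite mulmxA mulmxV// mul1mx. Qed.

Lemma cayley_orthogonal S : skew_mx S -> orthogonal_mx (cayley S).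
Proof.
move=> skS; apply: mulmx1C; rewrite trmx_mul.
set P := 1%:M - _; have Pu : P \in unitmx by exact: skew_unit.
have PT : 1%:M + 2^-1 *: S = P^T.
  by rewrite /P linearB /= linearZ /= skS scalerN opprK trmx1.
rewrite trmx_inv PT trmxK.
have comm : P^T *m P = P *m P^T.
  by rewrite -PT /P !(mulmxBl, mulmxDl, mulmxBr, mulmxDr, mulmxN, mulNmx, mulmx1, mul1mx); mx_lin.
rewrite /cayley -/P PT -mulmxA (mulmxA P^T) comm -mulmxA mulmxV ?unitmx_tr// mulmx1.
by rewrite mulVmx.
Qed.

Lemma cayley_comm S Z : skew_mx S -> Z *m S = S *m Z ->
  Z *m cayley S = cayley S *m Z.
Proof.
move=> skS ZS; apply: (can_inj (mulKmx (skew_unit skS))).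
rewrite [RHS]mulmxA cayleyP// mulmxA.
have -> : (1%:M - 2^-1 *: S) *m Z = Z *m (1%:M - 2^-1 *: S).
  by rewrite mulmxBl mulmxBr -scalemxAl -scalemxAr ZS mulmx1 mul1mx.
by rewrite -mulmxA cayleyP// mulmxDl mulmxDr -scalemxAl -scalemxAr ZS mulmx1 mul1mx.
Qed.

(** An exact identity. With [P = 1 - S/2] and [Q = cayley S], it follows on multiplying by [P],
    since [P Q = 1 + S/2] and [P (Q + 1) = 2]. The last term is cubic in [S] with a factor bounded
    by orthogonality. *)
Lemma cayley_taylor S : skew_mx S ->
  cayley S = 1%:M + S + 2^-1 *: (S *m S)
             + 8^-1 *: ((cayley S + 1%:M) *m (S *m (S *m S))).
Proof.
move=> skS; apply: (can_inj (mulKmx (skew_unit skS))).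
set P := 1%:M - _ => /=; set Q := cayley S.
have PQ : P *m Q = 1%:M + 2^-1 *: S by exact: cayleyP.
have PQ1 : P *m (Q + 1%:M) = 2 *: 1%:M by rewrite mulmxDr PQ mulmx1; mx_lin.
rewrite PQ mulmxDr -scalemxAr (mulmxA P (Q + _)) PQ1 -scalemxAl mul1mx scalerA.
rewrite /P !(mulmxBl, mulmxDl, mulmxDr) -!scalemxAl !mul1mx -!scalemxAr !mulmx1.
by mx_lin.
Qed.
End Cayley.

(** * Estimates for the entrywise maximum norm *)

Section Norm.
Variable R : realType.

Lemma mx_entry_le m p (A : 'M[R]_(m, p)) i j : `|A i j| <= `|A|.
Proof.
rewrite [leRHS]/Num.Def.normr /= mx_normrE.
by apply/bigmax_geP; right => /=; exists (i, j).
Qed.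

Lemma mx_norm_le m p (A : 'M[R]_(m, p)) c : 0 <= c ->
  (forall i j, `|A i j| <= c) -> `|A| <= c.
Proof.
by move=> c0 Ac; rewrite [leLHS]/Num.Def.normr /= mx_normrE (bigmax_le _ c0)// => -[i j] _.
Qed.

(** The maximum norm is not submultiplicative: each entry of the product is a sum of [p] terms,
    whence the factor [p]. *)
Lemma mx_normM m p q (A : 'M[R]_(m, p)) (B : 'M[R]_(p, q)) :
  `|A *m B| <= p%:R * (`|A| * `|B|).
Proof.
apply: mx_norm_le => [|i j]; first by rewrite !mulr_ge0.
rewrite mxE (le_trans (ler_norm_sum _ _ _))//.
rewrite (@le_trans _ _ (\sum_(k < p) `|A| * `|B|))//; last first.
  by rewrite sumr_const card_ord mulr_natl.
by apply: ler_sum => k _; rewrite normrM ler_pM// mx_entry_le.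
Qed.

Lemma mx_norm_tr m p (A : 'M[R]_(m, p)) : `|A^T| = `|A|.
Proof.
apply/eqP; rewrite eq_le; apply/andP; split; apply: mx_norm_le => // i j.
  by rewrite mxE mx_entry_le.
by rewrite -[A]trmxK mxE trmxK mx_entry_le.
Qed.

Lemma orthogonal_norm_le n (U : 'M[R]_n) : orthogonal_mx U -> `|U| <= 1.
Proof.
move=> /matrixP UU; apply: mx_norm_le => // i j.
have := UU j j; rewrite mxE mxE eqxx mulr1n => s1.
rewrite -(@expr_le1 _ 2)// real_normK ?num_real// -s1 (bigD1 i)//= mxE -expr2.
by rewrite lerDl sumr_ge0// => k _; rewrite mxE -expr2 sqr_ge0.
Qed.
End Norm.

(** * Second-order expansions *)

Section Taylor.
Variable R : realType.

(** This is O(t^k) as t decreases to 0; asking for the bound on the whole of ]0, 1] lets constants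
    be combined without neighbourhoods. *)
Definition remainder (k m p : nat) (F : R -> 'M[R]_(m, p)) :=
  exists C, forall t, 0 < t <= 1 -> `|F t| <= C * t ^+ k.

Lemma remainderP k m p (F : R -> 'M[R]_(m, p)) : remainder k F ->
  exists2 C, 0 <= C & forall t, 0 < t <= 1 -> `|F t| <= C * t ^+ k.
Proof.
move=> [C FC]; exists `|C| => // t t01; apply: le_trans (FC t t01) _.
by apply: ler_wpM2r (ler_norm _); case/andP: t01 => /ltW t0 _; exact: exprn_ge0.
Qed.

Lemma remainderD k m p (F G : R -> 'M[R]_(m, p)) :
  remainder k F -> remainder k G -> remainder k (fun t => F t + G t).
Proof.
move=> [C FC] [D GD]; exists (C + D) => t t01.
by rewrite mulrDl (le_trans (ler_normD _ _))// lerD ?FC ?GD.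
Qed.

Lemma remainderM k l m p q (F : R -> 'M[R]_(m, p)) (G : R -> 'M[R]_(p, q)) :
  remainder k F -> remainder l G -> remainder (k + l) (fun t => F t *m G t).
Proof.
move=> /remainderP[C C0 FC] /remainderP[D D0 GD]; exists (p%:R * (C * D)) => t t01.
rewrite exprD -mulrA mulrACA (le_trans (mx_normM _ _))// ler_wpM2l//.
by rewrite ler_pM ?FC ?GD.
Qed.

Lemma remainder_cst m p (A : 'M[R]_(m, p)) : remainder 0 (fun=> A).
Proof. by exists `|A| => t _; rewrite expr0 mulr1. Qed.

Lemma remainder_scale k l m p (F : R -> 'M[R]_(m, p)) :
  remainder l F -> remainder (k + l) (fun t => t ^+ k *: F t).
Proof.
move=> [C FC]; exists C => t t01; have /andP[/ltW t0 _] := t01.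
by rewrite normrZ normrX ger0_norm// exprD mulrCA ler_wpM2l ?exprn_ge0 ?FC.
Qed.

Lemma remainder_mono k l m p (F : R -> 'M[R]_(m, p)) : (k <= l)%N ->
  remainder l F -> remainder k F.
Proof.
move=> kl /remainderP[C C0 FC]; exists C => t t01; apply: le_trans (FC t t01) _.
by case/andP: t01 => /ltW t0 t1; rewrite ler_wpM2l// ler_wiXn2l.
Qed.

Lemma remainder_tr k m p (F : R -> 'M[R]_(m, p)) :
  remainder k F -> remainder k (fun t => (F t)^T).
Proof. by move=> [C FC]; exists C => t t01; rewrite mx_norm_tr FC. Qed.

Lemma remainder_scalar k m p a (F : R -> 'M[R]_(m, p)) :
  remainder k F -> remainder k (fun t => a *: F t).
Proof.
move=> [C FC]; exists (`|a| * C) => t t01.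
by rewrite normrZ -mulrA ler_wpM2l ?FC.
Qed.

Definition taylor2 m p (F : R -> 'M[R]_(m, p)) A0 A1 A2 :=
  remainder 3 (fun t => F t - (A0 + t *: A1 + t ^+ 2 *: A2)).

Lemma remainder_poly2 m p (A0 A1 A2 : 'M[R]_(m, p)) :
  remainder 0 (fun t => A0 + t *: A1 + t ^+ 2 *: A2).
Proof.
apply: remainderD; first apply: remainderD (remainder_cst _) _.
  exact: remainder_mono (remainder_scale 1 (remainder_cst A1)).
exact: remainder_mono (remainder_scale 2 (remainder_cst A2)).
Qed.

Lemma taylor2_bounded m p (F : R -> 'M[R]_(m, p)) A0 A1 A2 :
  taylor2 F A0 A1 A2 -> remainder 0 F.
Proof.
move=> /(@remainder_mono 0) - /(_ isT) h.
rewrite (_ : F = fun t => (F t - (A0 + t *: A1 + t ^+ 2 *: A2)) +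
                          (A0 + t *: A1 + t ^+ 2 *: A2)).
  exact: remainderD h (remainder_poly2 _ _ _).
by apply/funext => t; rewrite subrK.
Qed.

(** With [P], [Q] the quadratic parts, [F G - P Q = (F - P) G + P (G - Q)], and [P Q] exceeds its
    own quadratic part by a multiple of [t ^+ 3]. *)
Lemma taylor2M m p q (F : R -> 'M[R]_(m, p)) (G : R -> 'M[R]_(p, q))
    A0 A1 A2 B0 B1 B2 :
  taylor2 F A0 A1 A2 -> taylor2 G B0 B1 B2 ->
  taylor2 (fun t => F t *m G t) (A0 *m B0) (A0 *m B1 + A1 *m B0)
    (A0 *m B2 + A1 *m B1 + A2 *m B0).
Proof.
move=> hF hG; have G0 := taylor2_bounded hG.
pose P t := A0 + t *: A1 + t ^+ 2 *: A2.
pose Q t := B0 + t *: B1 + t ^+ 2 *: B2.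
rewrite /taylor2 (_ : (fun t => _) = fun t => (F t - P t) *m G t +
  (P t *m (G t - Q t) + t ^+ 3 *: (A1 *m B2 + A2 *m B1 + t *: (A2 *m B2)))).
  apply: remainderD; first exact: (remainderM hF G0).
  apply: remainderD; first exact: (remainderM (remainder_poly2 _ _ _) hG).
  apply: (@remainder_scale 3 0); apply: remainderD (remainder_cst _) _.
  exact: remainder_mono (remainder_scale 1 (remainder_cst _)).
apply/funext => t; rewrite mulmxBl mulmxBr /P /Q.
rewrite !(mulmxDl, mulmxDr) -!(scalemxAl, scalemxAr).
apply/matrixP => i j; rewrite !mxE; ring.
Qed.

Lemma taylor2_tr m p (F : R -> 'M[R]_(m, p)) A0 A1 A2 :
  taylor2 F A0 A1 A2 -> taylor2 (fun t => (F t)^T) A0^T A1^T A2^T.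
Proof.
move=> /remainder_tr; rewrite /taylor2; congr (remainder _ _).
by apply/funext => t; apply/matrixP => i j; rewrite !mxE.
Qed.

Lemma taylor2_cst n (A : 'M[R]_n) : taylor2 (fun=> A) A 0 0.
Proof.
exists 0 => t _; rewrite mul0r !scaler0 !addr0 subrr normr0//.
Qed.

(** * Expansion of conjugation by Cayley transforms *)

Section Cayley_taylor.
Variables (n : nat) (S1 S2 : 'M[R]_n).
Hypotheses (skS1 : skew_mx S1) (skS2 : skew_mx S2).

Let S t := t *: S1 + t ^+ 2 *: S2.

Lemma skew_path t : skew_mx (S t).
Proof. by rewrite /skew_mx /S linearD !linearZ/= skS1 skS2 !scalerN -opprD. Qed.

(** Since [S t] is O(t) and Cayley transforms are bounded, the last term of [cayley_taylor] is
    O(t^3); the cross terms of the square of [S t] are O(t^3) too. *)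
Lemma taylor2_cayley :
  taylor2 (fun t => cayley (S t)) 1%:M S1 (S2 + 2^-1 *: (S1 *m S1)).
Proof.
have remS : remainder 1 S.
  apply: remainderD; first exact: (@remainder_scale 1 0 _ _ _ (remainder_cst _)).
  exact: remainder_mono (@remainder_scale 2 0 _ _ _ (remainder_cst _)).
have remQ : remainder 0 (fun t => cayley (S t)).
  exists 1 => t _; rewrite expr0 mulr1.
  exact/orthogonal_norm_le/cayley_orthogonal/skew_path.
rewrite /taylor2 (_ : (fun t => _) = fun t =>
   t ^+ 3 *: (2^-1 *: (S1 *m S2 + S2 *m S1 + t *: (S2 *m S2))) +
   8^-1 *: ((cayley (S t) + 1%:M) *m (S t *m (S t *m S t)))).
  apply: remainderD.
    apply: (@remainder_scale 3 0); apply: remainder_scalar.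
    apply: remainderD (remainder_cst _) _.
    exact: remainder_mono (remainder_scale 1 (remainder_cst _)).
  apply: remainder_scalar; apply: (@remainderM 0 3).
    exact: remainderD remQ (remainder_cst _).
  by apply: (@remainderM 1 2) => //; exact: (@remainderM 1 1).
apply/funext => t; rewrite [X in X - _](cayley_taylor (skew_path t)).
set W := _ *m (_ *m (_ *m _)); rewrite /S !(mulmxDl, mulmxDr) -!(scalemxAl, scalemxAr).
apply/matrixP => i j; rewrite !mxE; move: (i == j)%:R 2^-1 8^-1 => b a c; ring.
Qed.

(** [S1] changes the first-order term by its commutator with [A0], and [S2] enters the second-order
    term only through its commutator with [A0]; this is what lets the two be chosen to clear
    prescribed entries. *)
Lemma taylor2_conj (F : R -> 'M[R]_n) A0 A1 A2 : taylor2 F A0 A1 A2 ->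
  taylor2 (fun t => (cayley (S t))^T *m F t *m cayley (S t)) A0
    (A1 + (A0 *m S1 - S1 *m A0))
    (A2 + (A1 *m S1 - S1 *m A1) + (A0 *m S2 - S2 *m A0)
     + (2^-1 *: (A0 *m S1 *m S1) + 2^-1 *: (S1 *m S1 *m A0) - S1 *m A0 *m S1)).
Proof.
move=> hF; have hQ := taylor2_cayley.
have := taylor2M (taylor2M (taylor2_tr hQ) hF) hQ.
rewrite !trmx1 !linearD !linearZ/= !trmx_mul skS1 skS2 !mulNmx !mulmxN opprK.
rewrite !(mulmxDl, mulmxDr) -!(scalemxAl, scalemxAr) !mul1mx !mulmx1.
rewrite ?mulNmx ?mulmxA.
set B1 := (X in taylor2 _ A0 X _); set B2 := (X in taylor2 _ A0 B1 X).
move=> h; set B1' := (X in taylor2 _ A0 X _); set B2' := (X in taylor2 _ A0 B1' X).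
have <- : B1 = B1' by rewrite /B1 /B1'; mx_lin.
by have <- : B2 = B2' by rewrite /B2 /B2'; mx_lin.
Qed.
End Cayley_taylor.
End Taylor.

(** * Diagonalization inside a commutant *)

Section SpectralTheorem.
Variable R : realType.

Lemma continuous_mulmx_entry (T : topologicalType) m p q
    (F : T -> 'M[R]_(m, p)) (G : T -> 'M[R]_(p, q)) :
  (forall i j, continuous (fun x => F x i j)) ->
  (forall i j, continuous (fun x => G x i j)) ->
  forall i j, continuous (fun x => (F x *m G x) i j).
Proof.
move=> cF cG i j.
rewrite (_ : (fun x => _) = fun x => \sum_(k < p) F x i k * G x k j).
  move=> x; apply: (@cvg_big R 'I_p +%R 0 xpredT (@add_continuous _)) => // k _.
  by apply: continuousM; [exact: cF|exact: cG].
by apply/funext => x; rewrite mxE.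
Qed.

Lemma continuous_mxtrace (T : topologicalType) m (F : T -> 'M[R]_m) :
  (forall i j, continuous (fun x => F x i j)) -> continuous (fun x => \tr (F x)).
Proof.
move=> cF x; apply: (@cvg_big R 'I_m +%R 0 xpredT (@add_continuous _)) => // k _.
exact: cF.
Qed.

Lemma closed_mx_eq0 (T : topologicalType) m p (F : T -> 'M[R]_(m, p)) :
  (forall i j, continuous (fun x => F x i j)) -> closed [set x | F x = 0].
Proof.
move=> cF.
rewrite (_ : mkset _ = \bigcap_i [set x | F x i.1 i.2 = 0]).
  apply: closed_bigI => i _; apply: (@closed_comp _ _ _ [set x | x = 0]) => [x _|].
    exact: cF.
  exact: closed_eq.
apply/seteqP; split=> [x /= Fx0 i _ /=|x Fx0]; first by rewrite Fx0 mxE.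
by apply/matrixP => i j; rewrite mxE; exact: (Fx0 (i, j)).
Qed.

Lemma continuous_subr_entry (T : topologicalType) m p
    (F G : T -> 'M[R]_(m, p)) :
  (forall i j, continuous (fun x => F x i j)) ->
  (forall i j, continuous (fun x => G x i j)) ->
  forall i j, continuous (fun x => (F x - G x) i j).
Proof.
move=> cF cG i j; rewrite (_ : (fun x => _) = fun x => F x i j - G x i j).
  by move=> x; apply: continuousB; [exact: cF|exact: cG].
by apply/funext => x; rewrite !mxE.
Qed.

Lemma norm_mxtrace_le n (A : 'M[R]_n) : `|\tr A| <= n%:R * `|A|.
Proof.
rewrite (le_trans (ler_norm_sum _ _ _))//.
rewrite (@le_trans _ _ (\sum_(k < n) `|A|))//; last first.
  by rewrite sumr_const card_ord mulr_natl.
by apply: ler_sum => k _; rewrite mx_entry_le.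
Qed.

Lemma mxtrace_trmul_eq0 n (A : 'M[R]_n) : \tr (A^T *m A) <= 0 -> A = 0.
Proof.
move=> trA; have sq i : true -> 0 <= (A^T *m A) i i.
  by rewrite mxE sumr_ge0// => k _; rewrite mxE -expr2 sqr_ge0.
have tr0 : \sum_i (A^T *m A) i i = 0.
  by apply/eqP; rewrite eq_le trA sumr_ge0.
apply/matrixP => k i; have := psumr_eq0P sq tr0 (i := i) isT.
rewrite mxE => sum0.
have sq' l : true -> 0 <= A^T i l * A l i by rewrite mxE -expr2 sqr_ge0.
have := psumr_eq0P sq' sum0 (i := k) isT.
by rewrite !mxE => /eqP; rewrite mulf_eq0 orbb => /eqP.
Qed.

Variable n : nat.

(** Along the Cayley curve the trace is [\tr (C *m B)] plus [t] times the left-hand side plus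
    O(t^2), so a positive derivative would contradict maximality for small [t]. *)
Lemma first_order_trace_max (C B S : 'M[R]_n) : skew_mx S ->
  (forall t, 0 < t <= 1 ->
     \tr (C *m ((cayley (t *: S))^T *m B *m cayley (t *: S))) <= \tr (C *m B)) ->
  \tr (C *m (B *m S - S *m B)) <= 0.
Proof.
move=> skS maxB; set s := \tr _.
have sk0 : skew_mx (0 : 'M[R]_n) by rewrite /skew_mx trmx0 oppr0.
have := taylor2_conj skS sk0 (taylor2_cst B).
rewrite add0r; set B2 := (X in taylor2 _ _ _ X) => hT.
pose F t := (cayley (t *: S))^T *m B *m cayley (t *: S).
have /remainderP[c c0 hc] : remainder 2 (fun t => C *m (F t - B - t *: (B *m S - S *m B))).
  apply: (@remainderM _ 0 2); first exact: remainder_cst.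
  have hT' := remainder_mono (isT : (2 <= 3)%N) hT.
  have := remainderD hT' (@remainder_scale _ 2 0 _ _ _ (remainder_cst B2)).
  rewrite /remainder => -[K hK]; exists K => t t01.
  apply: le_trans (hK t t01); rewrite /F scaler0 addr0 le_eqVlt; apply/orP; left.
  by apply/eqP; congr `|_|; mx_lin.
have key t : 0 < t <= 1 -> s <= n%:R * c * t.
  move=> t01; have /andP[t0 t1] := t01.
  rewrite -(ler_pM2r t0) (_ : _ * t * t = n%:R * (c * t ^+ 2)); last by ring.
  have := maxB t t01; rewrite -/(F t) => hmax.
  have := le_trans (norm_mxtrace_le _) (ler_wpM2l (ler0n _ n) (hc t t01)).
  rewrite ler_norml (mulmxBr C (F t - B)) (mulmxBr C (F t)) -scalemxAr.
  rewrite raddfB/= raddfB/= mxtraceZ -/s => /andP[+ _]; move: (\tr _) (\tr _) hmax => x y.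
  move: (_ * (c * _)) => z.
  lra.
rewrite leNgt; apply/negP => s0.
have d0 : 0 <= n%:R * c by rewrite mulr_ge0.
have sd : 0 < s + n%:R * c by rewrite ltr_wpDr.
(* This [t] lies in ]0, 1], and there [key] reads [s * (s + n c) <= n c * s], impossible for
   [s > 0]. *)
have := key (s / (s + n%:R * c)); rewrite divr_gt0//= ler_pdivrMr// mul1r lerDl d0.
move=> /(_ isT); rewrite mulrA ler_pdivlMr//; nra.
Qed.

(* Maximize tr (C U^T D U), C = diag (0, ..., n - 1), over the orthogonal U in the
   commutant of Zs. At a maximizer the first variation along the Cayley transform of
   S = [B, C], B = U^T D U, is tr (S^T S), so B commutes with C and is diagonal. *)
Theorem diagonalize_in_commutant (Zs : set 'rV[R]_n) (D : 'M[R]_n) :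
  D^T = D -> (forall z, Zs z -> diag_mx z *m D = D *m diag_mx z) ->
  exists (U : 'M[R]_n) (d : 'rV[R]_n),
    [/\ orthogonal_mx U, forall z, Zs z -> diag_mx z *m U = U *m diag_mx z &
        U^T *m D *m U = diag_mx d].
Proof.
move=> symD commD.
(* Matrices are flattened to row vectors, the setting of [bounded_closed_compact] and
   [EVT_max_rV]. *)
pose K := [set v : 'rV[R]_(n * n) | (vec_mx v)^T *m vec_mx v - 1%:M = 0] `&`
  \bigcap_(z in Zs) [set v : 'rV[R]_(n * n) |
     diag_mx z *m vec_mx v - vec_mx v *m diag_mx z = 0].
pose C : 'M[R]_n := diag_mx (\row_i (i : nat)%:R).
pose f (v : 'rV[R]_(n * n)) := \tr (C *m ((vec_mx v)^T *m D *m vec_mx v)).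
have cV i j : continuous (fun v : 'rV[R]_(n * n) => vec_mx v i j).
  rewrite (_ : (fun v => _) = fun v : 'rV[R]_(n * n) => v 0 (mxvec_index i j)).
    exact: coord_continuous.
  by apply/funext => v; rewrite mxE.
have cVT i j : continuous (fun v : 'rV[R]_(n * n) => (vec_mx v)^T i j).
  rewrite (_ : (fun v => _) = fun v : 'rV[R]_(n * n) => vec_mx v j i) //.
  by apply/funext => v; rewrite mxE.
have cc m p (A : 'M[R]_(m, p)) i j : continuous (fun v : 'rV[R]_(n * n) => A i j).
  exact: cst_continuous.
have K1 : K (mxvec 1%:M).
  split => /=; first by rewrite mxvecK trmx1 mulmx1 subrr.
  by move=> z _ /=; rewrite mxvecK mulmx1 mul1mx subrr.
have cK : compact K.
  apply: bounded_closed_compact.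
    exists 1; split => [|M M1 v [/eqP]]; first exact: num_real.
    rewrite subr_eq0 => /eqP oV _; apply: le_trans (ltW M1).
    apply: le_trans (orthogonal_norm_le oV); apply: mx_norm_le => // i j.
    by case/mxvec_indexP: j => k l; rewrite ord1 -[v]vec_mxK mxvecE vec_mxK mx_entry_le.
  apply: closedI.
    by apply: closed_mx_eq0; apply: continuous_subr_entry => //; apply: continuous_mulmx_entry.
  apply: closed_bigI => z _; apply: closed_mx_eq0.
  by apply: continuous_subr_entry; apply: continuous_mulmx_entry.
have cf : {within K, continuous f}.
  apply: continuous_subspaceT; apply: continuous_mxtrace.
  by do 3![apply: continuous_mulmx_entry => //].
have [v /set_mem[/= /eqP]] := EVT_max_rV (ex_intro _ _ K1) cK cf.
rewrite subr_eq0 => /eqP; set U := vec_mx v => oU commU maxU.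
have [B BE] : exists B, B = U^T *m D *m U by exists (U^T *m D *m U).
have symB : B^T = B by rewrite BE !trmx_mul trmxK symD mulmxA.
have commUz z : Zs z -> diag_mx z *m U = U *m diag_mx z.
  by move=> Zz; apply/eqP; rewrite -subr_eq0; apply/eqP; exact: commU.
have commUT z : Zs z -> diag_mx z *m U^T = U^T *m diag_mx z.
  move=> /commUz/(congr1 trmx); rewrite !trmx_mul !tr_diag_mx => ->//.
have commB z : Zs z -> diag_mx z *m B = B *m diag_mx z.
  move=> Zz; rewrite BE !mulmxA commUT// -(mulmxA _ (diag_mx z) D) commD//.
  by rewrite -!mulmxA commUz.
have [S SE] : exists S, S = B *m C - C *m B by exists (B *m C - C *m B).
have skS : skew_mx S.
  by rewrite /skew_mx SE linearB/= (trmx_mul B) (trmx_mul C) symB tr_diag_mx opprB.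
have commS z : Zs z -> diag_mx z *m S = S *m diag_mx z.
  move=> Zz; rewrite SE mulmxBr mulmxBl; congr (_ - _).
    by rewrite mulmxA commB// -mulmxA diag_mxC mulmxA.
  by rewrite mulmxA diag_mxC -mulmxA commB// mulmxA.
have S0 : S = 0.
  apply: mxtrace_trmul_eq0.
  (* By cyclicity both sides are the trace of [- S *m S]. *)
  have -> : \tr (S^T *m S) = \tr (C *m (B *m S - S *m B)).
    rewrite skS mulmxBr raddfB/= (mulmxA C S) (mxtrace_mulC (C *m S) B) -raddfB/=.
    by rewrite !mulmxA -mulmxBl SE opprB.
  apply: first_order_trace_max => // t t01.
  have sktS : skew_mx (t *: S) by rewrite /skew_mx linearZ/= skS scalerN.
  set Q := cayley _; have oQ : orthogonal_mx Q by exact: cayley_orthogonal.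
  have UQ : (U *m Q)^T *m D *m (U *m Q) = Q^T *m B *m Q.
    by rewrite BE trmx_mul !mulmxA.
  have := maxU (mxvec (U *m Q)); rewrite /f mxvecK UQ -/U -BE; apply.
  apply/mem_set; split => /=; rewrite ?mxvecK.
    by rewrite trmx_mul -mulmxA (mulmxA U^T) oU mul1mx oQ subrr.
  move=> z Zz /=; rewrite mxvecK mulmxA commUz// -(mulmxA U) -(mulmxA U).
  rewrite (cayley_comm sktS) ?subrr//.
  by rewrite -scalemxAr -scalemxAl commS.
exists U; have /diag_mxP[d Bd] : is_diag_mx B; last by exists d; rewrite -BE.
apply/is_diag_mxP => i j ij; move/matrixP: S0 => /(_ i j).
rewrite SE mul_mx_diag mul_diag_mx !mxE mulrC -mulrBl => /eqP.
rewrite mulf_eq0 subr_eq0 eqr_nat eq_sym (negbTE ij)/= => /eqP//.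
Qed.
End SpectralTheorem.

(** * Eigenvalue vectors *)

Section Eigval.
Variables (R : realType) (n : nat).
Implicit Types (A B U V : 'M[R]_n) (v w : 'rV[R]_n).

(** Stated for total preorders, so that it sorts reals with ties as well as germs at [0^'+] of
    quadratic polynomials. *)
Lemma sorting_perm (r : rel 'I_n) : reflexive r -> transitive r -> total r ->
  exists s : 'S_n, forall i j : 'I_n, (i <= j)%N -> r (s i) (s j).
Proof.
move=> rr rt rtot; pose l := sort r (enum 'I_n).
have szl : size l = n by rewrite size_sort -cardE card_ord.
have ul : uniq l by rewrite sort_uniq enum_uniq.
have inj : injective (fun i : 'I_n => nth i l i).
  move=> i j; rewrite (set_nth_default j) ?szl// => /eqP.
  by rewrite nth_uniq ?szl// => /eqP /val_inj.
exists (perm inj) => i j ij; rewrite !permE (set_nth_default j) ?szl//.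
by apply: (sorted_leq_nth rt rr j (sort_sorted rtot _)); rewrite ?inE ?szl.
Qed.

Lemma char_poly_conj A V : orthogonal_mx V ->
  char_poly (V *m A *m V^T) = char_poly A.
Proof.
move=> oV; pose W := map_mx (@polyC R) V.
have WW : W^T *m W = 1%:M by rewrite /W map_trmx -map_mxM oV map_scalar_mx.
have WW' := mulmx1C WW.
rewrite /char_poly (_ : char_poly_mx _ = W *m char_poly_mx A *m W^T).
  by rewrite !det_mulmx mulrAC -det_mulmx WW' det1 mul1r.
rewrite /char_poly_mx mulmxBr mulmxBl !map_mxM -map_trmx -/W; congr (_ - _).
by rewrite scalar_mxC -mulmxA WW' mulmx1.
Qed.

(** The factorization of the characteristic polynomial fixes the multiset of roots, and a multiset
    of reals has only one sorted listing. *)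
Lemma eigval_vector_uniq A v w :
  is_eigval_vector A v -> is_eigval_vector A w -> v = w.
Proof.
move=> [sv cv] [sw cw].
pose l (v : 'rV[R]_n) := [seq v 0 i | i <- enum 'I_n].
have lprod (u : 'rV[R]_n) : \prod_(i < n) ('X - (u 0 i)%:P) = \prod_(x <- l u) ('X - x%:P).
  by rewrite big_map big_enum.
have sl (u : 'rV[R]_n) : (forall i j : 'I_n, (i <= j)%N -> u 0 j <= u 0 i) ->
    sorted (fun x y => y <= x) (l u).
  move=> su; rewrite sorted_map.
  have : sorted (relpre val leq) (enum 'I_n) by rewrite -sorted_map val_enum_ord iota_sorted.
  by apply: sub_sorted => i j; exact: su.
have lvw : l v = l w.
  apply: (@sorted_eq _ (fun x y : R => y <= x)) (sl _ sv) (sl _ sw) _.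
  - by move=> y x z yx zy; exact: le_trans zy yx.
  - by move=> x y; rewrite andbC => /le_anti.
  - by apply: prod_XsubC_eq; rewrite -!lprod -cv -cw.
by have /eq_in_map vw := lvw; apply/rowP => i; apply: vw; rewrite mem_enum.
Qed.

Lemma eigvalE A v : is_eigval_vector A v -> eigval A = v.
Proof.
move=> Av; rewrite /eigval; case: xgetP => [w _ Aw|/(_ v)//].
exact: eigval_vector_uniq Aw Av.
Qed.

Lemma orthogonalM U V : orthogonal_mx U -> orthogonal_mx V -> orthogonal_mx (U *m V).
Proof.
by move=> oU oV; rewrite /orthogonal_mx trmx_mul mulmxA -(mulmxA V^T) oU mulmx1.
Qed.

Lemma orthogonal_perm (s : 'S_n) : orthogonal_mx (perm_mx s : 'M[R]_n).
Proof. by rewrite /orthogonal_mx tr_perm_mx -perm_mxM mulVg perm_mx1. Qed.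

Lemma diag_mx_col_perm (s : 'S_n) v :
  diag_mx (col_perm s v) = perm_mx s *m diag_mx v *m (perm_mx s)^T.
Proof.
rewrite tr_perm_mx -col_permE -row_permE; apply/matrixP => i j; rewrite !mxE.
by rewrite (inj_eq perm_inj).
Qed.

Lemma eigval_vector_conj_diag V v : orthogonal_mx V ->
  (forall i j : 'I_n, (i <= j)%N -> v 0 j <= v 0 i) ->
  eigval (V *m diag_mx v *m V^T) = v.
Proof.
move=> oV sv; apply: eigvalE; split => //.
rewrite char_poly_conj// char_poly_trig ?diag_mx_is_trig//.
by apply: eq_bigr => i _; rewrite mxE eqxx.
Qed.

Lemma col_perm_conj_diag V v (s : 'S_n) :
  V *m diag_mx v *m V^T =
  V *m (perm_mx s)^T *m diag_mx (col_perm s v) *m (V *m (perm_mx s)^T)^T.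
Proof.
have o := orthogonal_perm s; rewrite diag_mx_col_perm trmx_mul trmxK !mulmxA.
by rewrite -(mulmxA V _ (perm_mx s)) o mulmx1 -(mulmxA _ _ (perm_mx s)) o mulmx1.
Qed.

Lemma orthogonal_tr U : orthogonal_mx U -> orthogonal_mx U^T.
Proof. by move=> oU; rewrite /orthogonal_mx trmxK; exact: mulmx1C. Qed.

Lemma eigval_conj_diag_perm V v (s : 'S_n) : orthogonal_mx V ->
  (forall i j : 'I_n, (i <= j)%N -> v 0 (s j) <= v 0 (s i)) ->
  eigval (V *m diag_mx v *m V^T) = col_perm s v.
Proof.
move=> oV sv; rewrite (col_perm_conj_diag _ _ s) eigval_vector_conj_diag//.
  by apply: orthogonalM => //; apply/orthogonal_tr/orthogonal_perm.
by move=> i j ij; rewrite !mxE sv.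
Qed.

Lemma eigval_conj_diag V v : orthogonal_mx V ->
  exists s : 'S_n, eigval (V *m diag_mx v *m V^T) = col_perm s v.
Proof.
move=> oV; have [|||s sP] := @sorting_perm (fun i j => v 0 j <= v 0 i).
- by move=> i /=.
- by move=> j i k /= ij jk; exact: le_trans jk ij.
- by move=> i j /=; exact: le_total.
by exists s; exact: eigval_conj_diag_perm.
Qed.

(** Diagonalization with an empty set of commutation constraints; the columns of the eigenbasis are
    then permuted to sort the eigenvalues. *)
Lemma spectral_decomposition A : is_sym_mx A ->
  exists2 V, orthogonal_mx V & A = V *m diag_mx (eigval A) *m V^T.
Proof.
move=> symA; have [//|U [d [oU _ UA]]] := @diagonalize_in_commutant R n set0 A symA.
have AE : A = U *m diag_mx d *m U^T.
  by rewrite -UA !mulmxA (mulmx1C oU) mul1mx -mulmxA (mulmx1C oU) mulmx1.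
have [s sP] := eigval_conj_diag d oU.
rewrite -AE in sP; exists (U *m (perm_mx s)^T).
  by apply: orthogonalM => //; apply/orthogonal_tr/orthogonal_perm.
by rewrite sP -col_perm_conj_diag.
Qed.

Lemma conj_diag_sym V v : is_sym_mx (V *m diag_mx v *m V^T).
Proof. by rewrite /is_sym_mx !trmx_mul trmxK tr_diag_mx mulmxA. Qed.

Lemma quad_form_diag v (y : 'rV[R]_n) :
  (y *m diag_mx v *m y^T) 0 0 = \sum_i v 0 i * y 0 i ^+ 2.
Proof.
rewrite mul_mx_diag mxE; apply: eq_bigr => i _; rewrite !mxE; ring.
Qed.

(** Each product [y_i y_j] is at most [(y_i ^+ 2 + y_j ^+ 2) / 2] in absolute value; summing over
    all pairs gives the factor [n]. *)
Lemma quad_form_le (M : 'M[R]_n) (y : 'rV[R]_n) :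
  (y *m M *m y^T) 0 0 <= n%:R * `|M| * (y *m y^T) 0 0.
Proof.
rewrite -mulmxA mxE [in leRHS]mxE.
have -> : n%:R * `|M| * (\sum_j y 0 j * y^T j 0) =
  \sum_i \sum_j `|M| * (2^-1 * (y 0 i ^+ 2 + y 0 j ^+ 2)).
  transitivity (\sum_(i < n) `|M| * (2^-1 * (n%:R * y 0 i ^+ 2 + \sum_j y 0 j ^+ 2))).
    rewrite -mulr_sumr -mulr_sumr big_split/= -mulr_sumr sumr_const card_ord.
    rewrite (eq_bigr (fun j => y 0 j ^+ 2)) => [|j _]; last by rewrite mxE expr2.
    by rewrite -mulr_natl; field.
  apply: eq_bigr => i _; rewrite -mulr_sumr -mulr_sumr big_split/= sumr_const card_ord.
  by rewrite mulr_natl.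
apply: ler_sum => i _; rewrite mxE mulr_sumr; apply: ler_sum => j _.
rewrite mxE mulrCA mulrC; have := mx_entry_le M i j.
rewrite ler_norml; move: (M i j) (y 0 i) (y 0 j) `|M| => m a b c /andP[h1 h2].
rewrite mulrC; have := sqr_ge0 (a - b); have := sqr_ge0 (a + b); nra.
Qed.
End Eigval.

(** * The Lipschitz property *)

Section Weyl.
Variables (R : realType) (n : nat).
Implicit Types (A B U V : 'M[R]_n) (v w : 'rV[R]_n).

Lemma orthogonal_quad U (x : 'rV[R]_n) : orthogonal_mx U ->
  (x *m U) *m (x *m U)^T = x *m x^T.
Proof.
by move=> oU; rewrite trmx_mul mulmxA -(mulmxA x) (mulmx1C oU) mulmx1.
Qed.

(* The n unknowns of y satisfy only n - 1 equations. *)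
Lemma exists_vector_in_both_flags W (k : 'I_n) : exists y : 'rV[R]_n,
  [/\ y != 0, forall j : 'I_n, (k < j)%N -> y 0 j = 0 &
      forall j : 'I_n, (j < k)%N -> (y *m W) 0 j = 0].
Proof.
(* Columns before [k] encode the equations on [y *m W], columns after [k] the equations on [y]; the
   zero column [k] makes [M] singular. *)
pose M := \matrix_(i, j) if (j < k)%N then W i j
                         else if j == k then 0 else (i == j)%:R : R.
have /det0P[y y0 yM] : \det M == 0.
  rewrite (expand_det_col M k) big1// => i _.
  by rewrite mxE ltnn eqxx mul0r.
exists y; split=> // j jk; move/matrixP: yM => /(_ 0 j); rewrite mxE [RHS]mxE => yM.
  apply: etrans yM; rewrite (bigD1 j)//= big1 => [|i ij]; rewrite mxE ltnNge (ltnW jk)/=.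
    by rewrite eqxx -val_eqE gtn_eqF// mulr1 addr0.
  by rewrite (negbTE ij) -val_eqE gtn_eqF// mulr0.
by rewrite mxE; apply: etrans yM; apply: eq_bigr => i _; rewrite mxE jk.
Qed.

Lemma eigval_sorted A : is_sym_mx A ->
  forall i j : 'I_n, (i <= j)%N -> eigval A 0 j <= eigval A 0 i.
Proof.
move=> /spectral_decomposition[V oV AE].
have [||| u uP] := @sorting_perm n (fun i j => eigval A 0 j <= eigval A 0 i).
- by move=> i /=.
- by move=> j i k /= ij jk; exact: le_trans jk ij.
- by move=> i j /=; exact: le_total.
have := eigval_conj_diag_perm oV uP; rewrite -AE => E i j ij.
by rewrite E !mxE uP.
Qed.

(** Weyl's inequality. A vector [x] is taken in the span of the first eigenvectors of [A], up to
    index [k], and in the span of the last ones of [B], from [k] on; its two quadratic forms bound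
    [eigval A 0 k] from above and [eigval B 0 k] from below. *)
Lemma eigval_le A B : is_sym_mx A -> is_sym_mx B ->
  forall k, eigval A 0 k <= eigval B 0 k + n%:R * `|A - B|.
Proof.
move=> sA sB k; have [U oU AE] := spectral_decomposition sA.
have [V oV BE] := spectral_decomposition sB.
set a := eigval A in AE *; set b := eigval B in BE *.
have [y [y0 yhi zlo]] := exists_vector_in_both_flags (U^T *m V) k.
pose x := y *m U^T; pose z := x *m V.
have zE (j : 'I_n) : (j < k)%N -> z 0 j = 0 by move=> jk; rewrite /z /x -mulmxA zlo.
have oUT := orthogonal_tr oU.
have yE : y = x *m U by rewrite /x -mulmxA oU mulmx1.
have xAx : (x *m A *m x^T) 0 0 = \sum_i a 0 i * y 0 i ^+ 2.
  by rewrite -quad_form_diag AE yE !trmx_mul !mulmxA.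
have xBx : (x *m B *m x^T) 0 0 = \sum_i b 0 i * z 0 i ^+ 2.
  by rewrite -quad_form_diag BE /z !trmx_mul !mulmxA.
have nrm (u : 'rV[R]_n) : (u *m u^T) 0 0 = \sum_i u 0 i ^+ 2.
  by rewrite mxE; apply: eq_bigr => i _; rewrite mxE.
have nyx : (x *m x^T) 0 0 = \sum_i y 0 i ^+ 2 by rewrite -nrm yE (orthogonal_quad x oU).
have nzx : (x *m x^T) 0 0 = \sum_i z 0 i ^+ 2 by rewrite -nrm (orthogonal_quad x oV).
have N0 : 0 < (x *m x^T) 0 0.
  rewrite lt_neqAle nyx sumr_ge0 ?andbT => [|i _]; last exact: sqr_ge0.
  apply/eqP => /esym s0; move/eqP: y0; apply; apply: mul_trmx_eq0.
  by apply/matrixP => i j; rewrite !ord1 nrm s0 mxE.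
have lowA : a 0 k * (x *m x^T) 0 0 <= (x *m A *m x^T) 0 0.
  rewrite xAx nyx mulr_sumr; apply: ler_sum => i _.
  have [ik|ki] := leqP i k; last by rewrite yhi// expr0n/= !mulr0.
  by rewrite ler_wpM2r ?sqr_ge0// eigval_sorted.
have uppB : (x *m B *m x^T) 0 0 <= b 0 k * (x *m x^T) 0 0.
  rewrite xBx nzx mulr_sumr; apply: ler_sum => i _.
  have [ki|ik] := leqP k i; last by rewrite zE// expr0n/= !mulr0.
  by rewrite ler_wpM2r ?sqr_ge0// eigval_sorted.
rewrite -(ler_pM2r N0) mulrDl (le_trans lowA)//.
rewrite (_ : (x *m A *m x^T) 0 0 = (x *m B *m x^T) 0 0 + (x *m (A - B) *m x^T) 0 0).
  by apply: lerD => //; exact: quad_form_le.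
by rewrite mulmxBr mulmxBl [X in _ + X]mxE [X in _ + (_ + X)]mxE addrC subrK.
Qed.

Lemma eigval_lipschitz A B : is_sym_mx A -> is_sym_mx B ->
  `|eigval A - eigval B| <= n%:R * `|A - B|.
Proof.
move=> sA sB; apply: mx_norm_le => [|i j]; first by rewrite mulr_ge0.
rewrite ord1 !mxE ler_norml; have := eigval_le sA sB j; have := eigval_le sB sA j.
by rewrite (distrC B A); lra.
Qed.

Definition eigenframe A : 'M[R]_n :=
  xget 1%:M [set V | orthogonal_mx V /\ A = V *m diag_mx (eigval A) *m V^T].

Lemma eigenframeP A : is_sym_mx A -> orthogonal_mx (eigenframe A) /\
  A = eigenframe A *m diag_mx (eigval A) *m (eigenframe A)^T.
Proof.
move=> /spectral_decomposition[V oV AE]; rewrite /eigenframe.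
by case: xgetP => [W _ []//|/(_ V)]; case.
Qed.

(** Linear in [v], which may be unsorted; this carries points and arcs of [Theta] to symmetric
    matrices. *)
Definition with_eigvals A v := eigenframe A *m diag_mx v *m (eigenframe A)^T.

Lemma with_eigvals_eigval A : is_sym_mx A -> with_eigvals A (eigval A) = A.
Proof. by move=> /eigenframeP[_ /esym]. Qed.

Lemma with_eigvalsD A v w : with_eigvals A (v + w) = with_eigvals A v + with_eigvals A w.
Proof. by rewrite /with_eigvals raddfD/= mulmxDr mulmxDl. Qed.

Lemma with_eigvalsZ A c v : with_eigvals A (c *: v) = c *: with_eigvals A v.
Proof. by rewrite /with_eigvals linearZ/= -scalemxAr -scalemxAl. Qed.

Lemma with_eigvalsB A v w : with_eigvals A (v - w) = with_eigvals A v - with_eigvals A w.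
Proof. by rewrite -scaleN1r with_eigvalsD with_eigvalsZ scaleN1r. Qed.

Lemma with_eigvals_sym A v : is_sym_mx (with_eigvals A v).
Proof. exact: conj_diag_sym. Qed.

Lemma eigval_with_eigvals A v : is_sym_mx A ->
  exists s : 'S_n, eigval (with_eigvals A v) = col_perm s v.
Proof. by move=> /eigenframeP[oV _]; exact: eigval_conj_diag. Qed.

(** Each of the two products with an orthogonal matrix, of norm at most 1, costs a factor [n]. *)
Lemma with_eigvals_norm A v : is_sym_mx A ->
  `|with_eigvals A v| <= n%:R ^+ 2 * `|v|.
Proof.
move=> /eigenframeP[oV _]; have V1 := orthogonal_norm_le oV.
have VT1 := orthogonal_norm_le (orthogonal_tr oV).
have dv : `|diag_mx v| <= `|v|.
  apply: mx_norm_le => // i j; rewrite mxE; case: eqP => _.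
    by rewrite mulr1n mx_entry_le.
  by rewrite mulr0n normr0.
rewrite (le_trans (mx_normM _ _))// expr2 -mulrA ler_wpM2l// -[leRHS]mulr1.
rewrite ler_pM// (le_trans (mx_normM _ _))// ler_wpM2l//.
by rewrite -[leRHS]mul1r ler_pM.
Qed.

Lemma col_perm_norm v (s : 'S_n) : `|col_perm s v| <= `|v|.
Proof. by apply: mx_norm_le => // i j; rewrite mxE mx_entry_le. Qed.

Lemma col_permK v (s : 'S_n) : col_perm s^-1 (col_perm s v) = v.
Proof. by apply/rowP => i; rewrite !mxE permKV. Qed.

Lemma spectral_set_with_eigvals (Theta : set 'rV[R]_n) A v :
  perm_symmetric Theta -> is_sym_mx A -> Theta v ->
  spectral_set Theta (with_eigvals A v).
Proof.
move=> symT sA Tv; split; first exact: with_eigvals_sym.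
by have [s ->] := eigval_with_eigvals v sA; exact: symT.
Qed.
End Weyl.

(** * Normal form *)

Section Expansion.
Variables (R : realType) (n : nat).
Implicit Types (A B H S U V W X : 'M[R]_n) (x d e v w : 'rV[R]_n).

Lemma eigval_conj U A : orthogonal_mx U -> eigval (U^T *m A *m U) = eigval A.
Proof.
move=> oU; rewrite /eigval; congr xget; apply/funext => v.
by rewrite /is_eigval_vector -{2}[U]trmxK char_poly_conj//; exact: orthogonal_tr.
Qed.

Lemma sym_conj U A : is_sym_mx A -> is_sym_mx (U^T *m A *m U).
Proof. by move=> sA; rewrite /is_sym_mx !trmx_mul trmxK sA mulmxA. Qed.

Lemma comm_diagP z A :
  (diag_mx z *m A = A *m diag_mx z) <-> forall i j, (z 0 i - z 0 j) * A i j = 0.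
Proof.
rewrite mul_diag_mx mul_mx_diag; split=> [/matrixP zA i j|zA].
  by have := zA i j; rewrite !mxE mulrBl => ->; rewrite mulrC subrr.
apply/matrixP => i j; rewrite !mxE; apply/eqP; rewrite -subr_eq0 (mulrC (A i j)).
by rewrite -mulrBl zA.
Qed.

(* The entry A i j / (x j - x i) is 0 by convention when x i = x j. *)
Lemma commutator_equation x A : is_sym_mx A -> exists S,
  [/\ skew_mx S, is_sym_mx (A + (diag_mx x *m S - S *m diag_mx x)),
      diag_mx x *m (A + (diag_mx x *m S - S *m diag_mx x)) =
        (A + (diag_mx x *m S - S *m diag_mx x)) *m diag_mx x &
      forall z, diag_mx z *m A = A *m diag_mx z -> diag_mx z *m S = S *m diag_mx z].
Proof.
move=> sA; pose S : 'M[R]_n := \matrix_(i, j) (A i j / (x 0 j - x 0 i)).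
have skS : skew_mx S.
  apply/matrixP => i j; rewrite !mxE -[in LHS]sA mxE -mulrN -invrN.
  by congr (_ / _); lra.
exists S; split=> //.
- rewrite /is_sym_mx linearD/= sA linearB/= !trmx_mul skS tr_diag_mx.
  by rewrite mulmxN mulNmx opprK; mx_lin.
- apply/comm_diagP => i j; rewrite mul_diag_mx mul_mx_diag !mxE.
  have [->|xij] := eqVneq (x 0 i) (x 0 j); first by rewrite subrr mul0r.
  have x0 : x 0 j - x 0 i != 0 by rewrite subr_eq0 eq_sym.
  by field.
(* Each entry of [S] is a multiple of the same entry of [A], so it vanishes wherever commutation
   with [diag_mx z] forces that of [A] to vanish. *)
- move=> z /comm_diagP zA; apply/comm_diagP => i j.
  by rewrite mxE mulrA zA mul0r.
Qed.

Lemma taylor2_conj_cst (F : R -> 'M[R]_n) A0 A1 A2 V : taylor2 F A0 A1 A2 ->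
  taylor2 (fun t => V^T *m F t *m V)
    (V^T *m A0 *m V) (V^T *m A1 *m V) (V^T *m A2 *m V).
Proof.
move=> hF; have := remainderM (remainderM (remainder_cst V^T) hF) (remainder_cst V).
rewrite /taylor2; congr (remainder _ _); apply/funext => t.
by rewrite mulmxBr mulmxBl !(mulmxDr, mulmxDl) -!(scalemxAr, scalemxAl).
Qed.

Lemma diag_mx_comm_conj V z : orthogonal_mx V -> diag_mx z *m V = V *m diag_mx z ->
  V^T *m diag_mx z *m V = diag_mx z.
Proof. by move=> oV zV; rewrite -mulmxA zV mulmxA oV mul1mx. Qed.

(** Five successive conjugations, [F1] to [F5], none of which changes the spectrum, diagonalize the
    coefficients of orders 0, 1 and 2 in turn, each preserving the diagonal terms already obtained.
    The Lipschitz bound then transfers the O(t^3) error to the eigenvalues. *)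
Lemma eigval_normal_form X H W : is_sym_mx X -> is_sym_mx H -> is_sym_mx W ->
  exists x d e, remainder 3 (fun t => eigval (X + t *: H + t ^+ 2 *: W)
                          - eigval (diag_mx (x + t *: d + t ^+ 2 *: e))).
Proof.
move=> sX sH sW; have sk0 : skew_mx (0 : 'M[R]_n) by rewrite /skew_mx trmx0 oppr0.
pose F0 t := X + t *: H + t ^+ 2 *: W.
have sF0 t : is_sym_mx (F0 t) by rewrite /is_sym_mx !linearD !linearZ/= sX sH sW.
have T0 : taylor2 F0 X H W by exists 0 => t _; rewrite subrr normr0 mul0r.
have [//|U0 [x [oU0 _ U0X]]] := @diagonalize_in_commutant R n set0 X sX.
pose F1 t := U0^T *m F0 t *m U0.
have T1 : taylor2 F1 _ _ _ := taylor2_conj_cst U0 T0; rewrite U0X in T1.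
have [S1 [skS1 sD xD _]] := commutator_equation x (sym_conj U0 sH).
pose F2 t := (cayley (t *: S1 + t ^+ 2 *: 0))^T *m F1 t *m cayley (t *: S1 + t ^+ 2 *: 0).
have T2 : taylor2 F2 _ _ _ := taylor2_conj skS1 sk0 T1.
have o2 t : orthogonal_mx (cayley (t *: S1 + t ^+ 2 *: 0)).
  exact: cayley_orthogonal (skew_path skS1 sk0 t).
move: (U0^T *m H *m U0) (U0^T *m W *m U0) sD xD (sym_conj U0 sH) (sym_conj U0 sW) T1 T2
  => H1 W1 + + sH1 sW1 T1.
set D := H1 + _; set E := (X in taylor2 _ _ _ X) => sD xD T2.
have sE : is_sym_mx E.
  rewrite /E mulmx0 mul0mx subrr addr0 /is_sym_mx !linearD/= !linearN/= !linearZ/=.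
  by rewrite !trmx_mul tr_diag_mx skS1 sH1 sW1 !(mulmxN, mulNmx) ?opprK ?mulmxA; mx_lin.
(* [V1] is sought in the commutant of [diag_mx x], so the constant term survives the conjugation. *)
have [|V1 [d [oV1 xV1 V1D]]] := @diagonalize_in_commutant R n [set x] D sD.
  by move=> z ->.
pose F3 t := V1^T *m F2 t *m V1.
have T3 : taylor2 F3 _ _ _ := taylor2_conj_cst V1 T2.
rewrite V1D (diag_mx_comm_conj oV1 (xV1 x erefl)) in T3.
(* [S3], used at order [t ^+ 2], makes the second-order term commute with [diag_mx x]; [S2], used at
   order [t], then makes it commute with [diag_mx d]. *)
have [S3 [skS3 sE1 xE1 _]] := commutator_equation x (sym_conj V1 sE).
have [S2 [skS2 sE2 dE2 E2comm]] := commutator_equation d sE1.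
have xS2 := E2comm _ xE1.
pose F4 t := (cayley (t *: S2 + t ^+ 2 *: S3))^T *m F3 t *m cayley (t *: S2 + t ^+ 2 *: S3).
have T4 : taylor2 F4 _ _ _ := taylor2_conj skS2 skS3 T3.
have o4 t : orthogonal_mx (cayley (t *: S2 + t ^+ 2 *: S3)).
  exact: cayley_orthogonal (skew_path skS2 skS3 t).
move: sE2 dE2 T4; set G := (_ + (_ - S3 *m _)) + _ => sG dG.
have xG : diag_mx x *m G = G *m diag_mx x.
  rewrite /G mulmxDr mulmxDl xE1; congr (_ + _); rewrite mulmxBr mulmxBl; congr (_ - _).
    by rewrite mulmxA diag_mxC -mulmxA xS2 mulmxA.
  by rewrite mulmxA xS2 -mulmxA diag_mxC mulmxA.
(* As [S2] commutes with [diag_mx x], the first-order term stays [diag_mx d] and the terms quadratic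
   in [S2] cancel. *)
rewrite xS2 subrr addr0 (_ : _ + _ + _ + _ = G); last first.
  by rewrite /G -(mulmxA S2 S2) -xS2 (mulmxA S2) -xS2; mx_lin.
move=> T4.
have [|V2 [e [oV2 V2c V2G]]] := @diagonalize_in_commutant R n [set z | z = x \/ z = d] G sG.
  by move=> z [->|->].
pose F5 t := V2^T *m F4 t *m V2.
have := taylor2_conj_cst V2 T4; rewrite -/F5 V2G.
rewrite (diag_mx_comm_conj oV2 (V2c x (or_introl erefl))).
rewrite (diag_mx_comm_conj oV2 (V2c d (or_intror erefl))) => -[C T5].
exists x, d, e, (n%:R * C) => t t01.
rewrite -/(F0 t) (_ : eigval (F0 t) = eigval (F5 t)); last by rewrite !eigval_conj.
rewrite (le_trans (eigval_lipschitz _ _))//.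
- by do ?apply: sym_conj.
- by rewrite /is_sym_mx tr_diag_mx.
rewrite -mulrA ler_wpM2l//; have := T5 t t01.
by rewrite (linearD (@diag_mx R n)) (linearD (@diag_mx R n)) !linearZ.
Qed.
End Expansion.

(** * Directional derivatives of the eigenvalues *)

Section Limits.
Variable R : realType.

Lemma quadratic_eventually_gt0 (a b c : R) : 0 < a ->
  \forall t \near 0^'+, 0 < a + t * b + t ^+ 2 * c.
Proof.
move=> a0; have m0 : 0 < `|b| + `|c| + 1 by rewrite ltr_wpDl// addr_ge0.
near=> t; have t0 : 0 < t by near: t; exact: nbhs_right_gt.
have t1 : t < 1 by near: t; exact: nbhs_right_lt.
have : t < a / (`|b| + `|c| + 1) by near: t; apply: nbhs_right_lt; rewrite divr_gt0.
rewrite ltr_pdivlMr// => ta.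
have hb : - `|b| <= b by rewrite lerNl -normrN ler_norm.
have hc : - `|c| <= c by rewrite lerNl -normrN ler_norm.
have c0 : 0 <= `|c| by [].
have : t * - `|b| <= t * b by rewrite ler_wpM2l// ltW.
have : t ^+ 2 * - `|c| <= t ^+ 2 * c by rewrite ler_wpM2l// sqr_ge0.
have : t ^+ 2 * `|c| <= t * `|c| by rewrite ler_wpM2r// expr2 ger_pMr// ltW.
nra.
Unshelve. all: by end_near. Qed.

(** The first nonzero coefficient decides the sign. This makes the comparison of quadratic germs at
    [0^'+] total. *)
Lemma quadratic_eventually_signed (a b c : R) :
  (\forall t \near 0^'+, 0 <= a + t * b + t ^+ 2 * c) \/
  (\forall t \near 0^'+, a + t * b + t ^+ 2 * c <= 0).
Proof.
have pos (a' b' c' : R) : 0 < a' -> \forall t \near 0^'+, 0 <= a' + t * b' + t ^+ 2 * c'.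
  by move=> /(quadratic_eventually_gt0 b' c'); apply: filterS => t /ltW.
have [a0|a0|->] := ltgtP a 0; [right| by left; exact: pos|].
  have : 0 < - a by rewrite oppr_gt0.
  by move=> /(pos _ (- b) (- c)); apply: filterS => t; lra.
have pos0 (b' c' : R) : 0 < b' -> \forall t \near 0^'+, 0 <= 0 + t * b' + t ^+ 2 * c'.
  move=> /(pos _ c' 0) h; near=> t.
  have -> : 0 + t * b' + t ^+ 2 * c' = t * (b' + t * c' + t ^+ 2 * 0) by ring.
  by apply: mulr_ge0; [near: t; exact: nbhs_right_ge|near: t].
have [b0|b0|->] := ltgtP b 0; [right| by left; exact: pos0|].
  have : 0 < - b by rewrite oppr_gt0.
  by move=> /(pos0 _ (- c)); apply: filterS => t; lra.
have [c0|c0] := leP 0 c; [left|right]; near=> t; rewrite mulr0 !add0r.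
  by rewrite mulr_ge0 ?sqr_ge0.
by rewrite mulr_ge0_le0 ?sqr_ge0 ?ltW.
Unshelve. all: by end_near. Qed.

Lemma small_norm_eq0 (V : normedModType R) (v : V) (C : R) :
  (\forall t \near 0^'+, `|v| <= C * t) -> v = 0.
Proof.
move=> h; apply/eqP; rewrite -normr_le0 leNgt; apply/negP => v0.
have C1 : 0 < `|C| + 1 by rewrite ltr_wpDl.
suff : \forall t \near (0 : R)^'+, False by move=> /filter_ex[].
near=> t; have t0 : 0 < t by near: t; exact: nbhs_right_gt.
have : `|v| <= C * t by near: t.
have : t < `|v| / (`|C| + 1) by near: t; apply: nbhs_right_lt; rewrite divr_gt0.
rewrite ltr_pdivlMr// mulrDr mulr1 => h1 h2.
have : C * t <= `|C| * t by apply: ler_wpM2r; [exact: ltW|exact: ler_norm].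
lra.
Unshelve. all: by end_near. Qed.

Lemma cvg_at_right_linear_bound (V : normedModType R) (f : R -> V) (l : V) (C : R) :
  (\forall t \near 0^'+, `|f t - l| <= C * t) -> f @ 0^'+ --> l.
Proof.
move=> h; apply/cvgrPdist_lt => e e0.
have C1 : 0 < `|C| + 1 by rewrite ltr_wpDl.
near=> t; have t0 : 0 < t by near: t; exact: nbhs_right_gt.
rewrite distrC (@le_lt_trans _ _ (C * t))//; first by near: t.
have : t < e / (`|C| + 1) by near: t; apply: nbhs_right_lt; rewrite divr_gt0.
rewrite ltr_pdivlMr// mulrDr mulr1 => h1.
have : C * t <= `|C| * t by apply: ler_wpM2r; [exact: ltW|exact: ler_norm].
lra.
Unshelve. all: by end_near. Qed.

Lemma mulr_normrZ (V : normedModType R) (k : R) (v : V) :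
  0 < k -> k * `|v| = `|k *: v|.
Proof. by move=> k0; rewrite normrZ gtr0_norm. Qed.

Variable n : nat.
Implicit Types (X H W : 'M[R]_n) (x d e a b c : 'rV[R]_n).

(** The indices are sorted by the germs of their quadratics; there are finitely many pairs, so one
    neighbourhood serves all comparisons. *)
Lemma eigval_diag_path x d e : exists s : 'S_n, \forall t \near 0^'+,
  eigval (diag_mx (x + t *: d + t ^+ 2 *: e)) = col_perm s (x + t *: d + t ^+ 2 *: e).
Proof.
pose q i t := x 0 i + t * d 0 i + t ^+ 2 * e 0 i.
pose r i j := `[< \forall t \near 0^'+, q j t <= q i t >].
have [|||s sP] := @sorting_perm n r.
- by move=> i; apply/asboolP; near=> t.
- move=> j i k /asboolP ij /asboolP jk; apply/asboolP; near=> t.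
  by apply: (@le_trans _ _ (q j t)); near: t.
- move=> i j; apply/orP.
  have [h|h] := quadratic_eventually_signed (x 0 i - x 0 j) (d 0 i - d 0 j) (e 0 i - e 0 j);
    [left|right]; apply/asboolP; apply: filterS h => t; rewrite /q; lra.
exists s.
have sP' : \forall t \near 0^'+, forall ij : 'I_n * 'I_n, (ij.1 <= ij.2)%N ->
    q (s ij.2) t <= q (s ij.1) t.
  apply: filter_forall => ij; have [ij12|_] := leqP ij.1 ij.2; last by near=> t.
  by have /asboolP := sP _ _ ij12; apply: filterS => t.
apply: filterS sP' => t st; set v := _ + _.
have o1 : orthogonal_mx (1%:M : 'M[R]_n) by rewrite /orthogonal_mx trmx1 mulmx1.
have := @eigval_conj_diag_perm R n _ v s o1.
rewrite trmx1 mulmx1 mul1mx; apply => i j ij; have := st (i, j) ij.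
by rewrite /q /v !mxE.
Unshelve. all: by end_near. Qed.

Lemma eigval_expansion X H W : is_sym_mx X -> is_sym_mx H -> is_sym_mx W ->
  exists a b c C, \forall t \near 0^'+,
    `|eigval (X + t *: H + t ^+ 2 *: W) - (a + t *: b + t ^+ 2 *: c)| <= C * t ^+ 3.
Proof.
move=> sX sH sW; have [x [d [e [C hC]]]] := eigval_normal_form sX sH sW.
have [s hs] := eigval_diag_path x d e.
exists (col_perm s x), (col_perm s d), (col_perm s e), C; near=> t.
have -> : col_perm s x + t *: col_perm s d + t ^+ 2 *: col_perm s e =
  eigval (diag_mx (x + t *: d + t ^+ 2 *: e)).
  have -> : eigval (diag_mx (x + t *: d + t ^+ 2 *: e)) =
    col_perm s (x + t *: d + t ^+ 2 *: e) by near: t.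
  by apply/rowP => i; rewrite !mxE.
apply: hC; apply/andP; split; first by near: t; exact: nbhs_right_gt.
by near: t; exact: nbhs_right_le.
Unshelve. all: by end_near. Qed.

Lemma sym_path X H W s t : is_sym_mx X -> is_sym_mx H -> is_sym_mx W ->
  is_sym_mx (X + s *: H + t *: W).
Proof. by move=> sX sH sW; rewrite /is_sym_mx !linearD !linearZ/= sX sH sW. Qed.

(** [K * t] collects the Lipschitz bound along the path, the nonconstant polynomial terms and the
    cubic error, all O(t) when [t <= 1]. *)
Lemma eigval_expansion_base X H W a b c C :
  is_sym_mx X -> is_sym_mx H -> is_sym_mx W ->
  (\forall t \near 0^'+,
    `|eigval (X + t *: H + t ^+ 2 *: W) - (a + t *: b + t ^+ 2 *: c)| <= C * t ^+ 3) ->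
  a = eigval X.
Proof.
move=> sX sH sW h; apply/eqP; rewrite -subr_eq0; apply/eqP.
pose K := n%:R * (`|H| + `|W|) + `|b| + `|c| + `|C|.
apply: (@small_norm_eq0 _ _ K).
near=> t; have t0 : 0 < t by near: t; exact: nbhs_right_gt.
have t1 : t <= 1 by near: t; exact: nbhs_right_le.
have h1 : `|eigval (X + t *: H + t ^+ 2 *: W) - (a + t *: b + t ^+ 2 *: c)| <= C * t ^+ 3.
  by near: t.
have h2 := eigval_lipschitz (sym_path t (t ^+ 2) sX sH sW) sX.
set E := eigval (_ + _ + _) in h1 h2.
have -> : a - eigval X = (E - eigval X) - (E - (a + t *: b + t ^+ 2 *: c))
   - (t *: b + t ^+ 2 *: c).
  by move: (E) (eigval X) => u v; apply/rowP => i; rewrite !mxE; ring.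
have tt : t ^+ 2 <= t by rewrite expr2 ger_pMr.
have ttt : t ^+ 3 <= t by rewrite exprS ger_pMr// exprn_ile1// ltW.
have hpath (m p : nat) (A B : 'M[R]_(m, p)) : `|t *: A + t ^+ 2 *: B| <= (`|A| + `|B|) * t.
  rewrite (le_trans (ler_normD _ _))// normrZ (normrZ (t ^+ 2)) normrX gtr0_norm// mulrDl.
  by rewrite lerD// mulrC// ler_wpM2l.
have h3 : `|E - eigval X| <= n%:R * (`|H| + `|W|) * t.
  rewrite (le_trans h2)// -mulrA ler_wpM2l//.
  by rewrite (_ : _ - X = t *: H + t ^+ 2 *: W) ?hpath//; mx_lin.
have h4 : C * t ^+ 3 <= `|C| * t.
  rewrite (@le_trans _ _ (`|C| * t ^+ 3))//.
    by apply: ler_wpM2r; [exact/exprn_ge0/ltW|exact: ler_norm].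
  by rewrite ler_wpM2l.
have h5 := hpath _ _ b c.
rewrite (le_trans (ler_normB _ _))// (le_trans (lerD (ler_normB _ _) (lexx _)))//.
rewrite /K; nra.
Unshelve. all: by end_near. Qed.

(** The expansion follows a path curved by [W], the derivative a straight one; by the Lipschitz
    bound the spectra differ by O(t^2), negligible after division by [t]. The quotient is shown to
    converge, so the [lim] in [eigval_d1] is genuine. *)
Lemma eigval_d1_expansion X H W b c C :
  is_sym_mx X -> is_sym_mx H -> is_sym_mx W ->
  (\forall t \near 0^'+,
    `|eigval (X + t *: H + t ^+ 2 *: W) - (eigval X + t *: b + t ^+ 2 *: c)| <= C * t ^+ 3) ->
  eigval_d1 X H = b.
Proof.
move=> sX sH sW h; apply: cvg_lim => //.
apply: (@cvg_at_right_linear_bound _ _ _ (n%:R * `|W| + `|c| + `|C|)).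
near=> t; have t0 : 0 < t by near: t; exact: nbhs_right_gt.
have t1 : t <= 1 by near: t; exact: nbhs_right_le.
have tn0 : t != 0 by rewrite gt_eqF.
set E := eigval (_ + _).
have h1 : `|eigval (X + t *: H + t ^+ 2 *: W) - (eigval X + t *: b + t ^+ 2 *: c)| <= C * t ^+ 3.
  by near: t.
have sXH : is_sym_mx (X + t *: H) by rewrite /is_sym_mx linearD linearZ/= sX sH.
have h2 := eigval_lipschitz sXH (sym_path t (t ^+ 2) sX sH sW).
rewrite -/E in h2; set E' := eigval (_ + _ + _) in h1 h2.
rewrite -(ler_pM2l t0) mulr_normrZ// scalerBr scalerA mulfV// scale1r.
have -> : E - eigval X - t *: b =
    (E - E') + (E' - (eigval X + t *: b + t ^+ 2 *: c)) + t ^+ 2 *: c.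
  by move: (E) (E') (eigval X) => u v w; apply/rowP => i; rewrite !mxE; ring.
have h3 : `|E - E'| <= n%:R * `|W| * t ^+ 2.
  rewrite (le_trans h2)// -mulrA ler_wpM2l// opprD addNKr normrN normrZ normrX.
  by rewrite gtr0_norm// mulrC.
have h4 : C * t ^+ 3 <= `|C| * t ^+ 2.
  rewrite (@le_trans _ _ (`|C| * t ^+ 3))//.
    by apply: ler_wpM2r; [exact/exprn_ge0/ltW|exact: ler_norm].
  by rewrite ler_wpM2l// exprS ger_pMl// exprn_gt0.
have h5 : `|t ^+ 2 *: c| = `|c| * t ^+ 2.
  by rewrite normrZ normrX gtr0_norm// mulrC.
rewrite (le_trans (ler_normD _ _))// h5.
rewrite (le_trans (lerD (ler_normD _ _) (lexx _)))//.
have -> : t * ((n%:R * `|W| + `|c| + `|C|) * t) =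
  n%:R * `|W| * t ^+ 2 + `|c| * t ^+ 2 + `|C| * t ^+ 2 by ring.
lra.
Unshelve. all: by end_near. Qed.

(** Convergence guarantees that the [lim] defining [eigval_d2] is a true limit. *)
Lemma eigval_d2_cvg X H W : is_sym_mx X -> is_sym_mx H -> is_sym_mx W ->
  (fun t : R => (2^-1 * t ^+ 2)^-1 *:
     (eigval (X + t *: H + (2^-1 * t ^+ 2) *: W) - eigval X - t *: eigval_d1 X H))
    @ 0^'+ --> eigval_d2 X H W.
Proof.
(* The expansion uses [t ^+ 2] and the parabolic path [2^-1 * t ^+ 2]: it is applied to [2^-1 *: W],
   and the limit is [2 *: c]. *)
move=> sX sH sW; have sW2 : is_sym_mx (2^-1 *: W) by rewrite /is_sym_mx linearZ/= sW.
have [a [b [c [C h]]]] := eigval_expansion sX sH sW2.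
have ax := eigval_expansion_base sX sH sW2 h; rewrite {}ax in h.
have -> := eigval_d1_expansion sX sH sW2 h.
set f := (X in X @ _).
suff : f @ 0^'+ --> 2 *: c.
  move=> fc; have := cvg_lim (@norm_hausdorff _ _) fc.
  by rewrite /eigval_d2 (eigval_d1_expansion sX sH sW2 h) -/f => ->.
apply: (@cvg_at_right_linear_bound _ _ _ (2 * C)).
near=> t; have t0 : 0 < t by near: t; exact: nbhs_right_gt.
have h1 : `|eigval (X + t *: H + t ^+ 2 *: (2^-1 *: W))
  - (eigval X + t *: b + t ^+ 2 *: c)| <= C * t ^+ 3 by near: t.
rewrite scalerA (mulrC (t ^+ 2)) in h1; rewrite /f.
move: (eigval _) (eigval X) h1 => u v h1.
have s0 : 0 < 2^-1 * t ^+ 2 by rewrite mulr_gt0// exprn_gt0.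
rewrite -(ler_pM2l s0) mulr_normrZ// scalerBr scalerA mulfV ?gt_eqF// scale1r.
rewrite scalerA (_ : _ * 2 = t ^+ 2); last by field.
rewrite (_ : _ * (2 * C * t) = C * t ^+ 3); last by field.
by move: h1; rewrite !opprD !addrA.
Unshelve. all: by end_near. Qed.

End Limits.

(** * Second-order tangent sets *)

Section Sequences.
Variable R : realType.

Lemma cvg_at_right_seq (T : topologicalType) (f : R -> T) (l : T) (t : nat -> R) :
  (forall k, 0 < t k) -> t @ \oo --> (0 : R) -> f @ 0^'+ --> l ->
  (fun k => f (t k)) @ \oo --> l.
Proof.
move=> t0 tc fl; apply: cvg_comp fl => A.
rewrite /at_right /within/= => /tc; rewrite !nbhs_simpl/=.
by apply: (@filterS nat) => k; apply; exact: t0.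
Qed.

(** Transfers convergence from matrices to eigenvalues or back, hence the two distinct spaces. *)
Lemma cvg_linear_norm (T : Type) (F : set_system T) (V W : normedModType R)
    (f : T -> V) (g : T -> W) (l : V) (m : W) (C : R) : Filter F ->
  (\forall x \near F, `|g x - m| <= C * `|f x - l|) ->
  f @ F --> l -> g @ F --> m.
Proof.
move=> FF gf /cvgrPdist_lt fl; apply/cvgrPdist_lt => e e0.
have C1 : 0 < `|C| + 1 by rewrite ltr_wpDl.
have := fl (e / (`|C| + 1)); rewrite divr_gt0// => /(_ isT) fl'.
near=> x; rewrite distrC (@le_lt_trans _ _ (C * `|f x - l|))//; first by near: x.
have : `|l - f x| < e / (`|C| + 1) by near: x.
rewrite distrC ltr_pdivlMr// mulrDr mulr1 => h.
have : C * `|f x - l| <= `|C| * `|f x - l| by rewrite ler_wpM2r// ler_norm.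
have : 0 <= `|f x - l| by [].
lra.
Unshelve. all: by end_near. Qed.

Lemma cvg_seq_norm_bounded (V : normedModType R) (u : nat -> V) (l : V) :
  u @ \oo --> l -> exists M, forall k, `|u k| <= M.
Proof.
move=> ul; have /cvg_seq_bounded[M [_ hM]] : cvg (u @ \oo) by apply/cvg_ex; exists l.
by exists (M + 1) => k; apply: hM; rewrite ?ltrDl.
Qed.

(** A cluster point exists by compactness, and [phi k] is picked beyond [k] within [k.+1%:R^-1] of
    it. The bound [k <= phi k] is what [cvg_subsequence] requires. *)
Lemma bounded_mx_subsequence m p (w : nat -> 'M[R]_(m, p)) (M : R) :
  (forall k, `|w k| <= M) ->
  exists phi (l : 'M[R]_(m, p)), (forall k, (k <= phi k)%N) /\ (fun k => w (phi k)) @ \oo --> l.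
Proof.
move=> wM; pose K := [set v : 'rV[R]_(m * p) | `|v| <= M].
have mxvec_norm (A : 'M[R]_(m, p)) : `|mxvec A| <= `|A|.
  apply: mx_norm_le => // i j; case/mxvec_indexP: j => k l.
  by rewrite ord1 mxvecE mx_entry_le.
have cK : compact K.
  apply: bounded_closed_compact.
    by exists M; split; [exact: num_real|move=> N MN v /le_trans; apply; exact: ltW].
  rewrite (_ : K = (fun v : 'rV[R]_(m * p) => `|v|) @^-1` [set x | x <= M])//.
  by apply: closed_comp => [v _|]; [exact: norm_continuous|exact: closed_le].
have FK : ((fun k => mxvec (w k)) @ \oo) K.
  by exists 0%N => // k _; exact: le_trans (mxvec_norm (w k)) (wM k).
have [v [Kv cv]] := cK _ _ FK.
have pick k : exists j, (k <= j)%N /\ `|v - mxvec (w j)| < k.+1%:R^-1.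
  have [] := cv [set mxvec (w j) | j in [set j | (k <= j)%N]] (ball v k.+1%:R^-1).
  - by exists k => // j kj; exists j.
  - by apply: nbhsx_ballx; rewrite invr_gt0.
  move=> _ [[j kj <-]]; rewrite -ball_normE/= => vj; exists j; split => //.
have [phi hphi] := choice pick.
exists phi, (vec_mx v); split=> [k|]; first by have [] := hphi k.
apply/cvgrPdist_lt => e e0; near=> k.
have [_ hk] := hphi k; apply: le_lt_trans (lt_trans hk _).
  apply: mx_norm_le => // i j.
  have := mx_entry_le (v - mxvec (w (phi k))) 0 (mxvec_index i j).
  by rewrite !mxE mxvecE.
near: k; exact: near_infty_natSinv_lt (PosNum e0).
Unshelve. all: by end_near. Qed.

Lemma cvg_subsequence (T : topologicalType) (u : nat -> T) (l : T) (phi : nat -> nat) :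
  (forall k, (k <= phi k)%N) -> u @ \oo --> l -> (fun k => u (phi k)) @ \oo --> l.
Proof.
move=> hphi ul; apply: cvg_comp ul => A [N _ hN]; exists N => // k /= Nk.
by apply: hN => /=; exact: leq_trans Nk (hphi k).
Qed.

(** The first quotient equals [w + (t / 2) q t], where [q] is the convergent second quotient. *)
Lemma second_quotient_first (V : normedModType R) (f : R -> V) (f0 w u : V) :
  (fun t => (2^-1 * t ^+ 2)^-1 *: (f t - f0 - t *: w)) @ 0^'+ --> u ->
  (fun t => t^-1 *: (f t - f0)) @ 0^'+ --> w.
Proof.
move=> fu; set q := (X in X @ _ --> _) in fu.
have h : (fun t => w + (2^-1 * t) *: q t) @ 0^'+ --> w.
  rewrite -[X in _ --> X]addr0 -(scale0r u); apply: cvgD; first exact: cvg_cst.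
  apply: cvgZ => //; rewrite -[X in _ --> X](mulr0 2^-1).
  by apply: cvgM; [exact: cvg_cst|exact: cvg_at_right_filter].
apply: cvg_trans h; apply: near_eq_cvg; near=> t.
have t0 : 0 < t by near: t; exact: nbhs_right_gt.
rewrite /q scalerA (_ : _ * _ = t^-1); last by field; rewrite gt_eqF.
by rewrite (scalerBr _ (f t - f0)) scalerA mulVf ?gt_eqF// scale1r addrC subrK.
Unshelve. all: by end_near. Qed.
End Sequences.

(** * The formula for second-order tangent sets of spectral sets *)

Section SpectralSets.
Variables (R : realType) (n : nat) (Theta : set 'rV[R]_n).
Hypothesis symTheta : perm_symmetric Theta.
Implicit Types (A X H W Y : 'M[R]_n) (u v w z : 'rV[R]_n).

Lemma closed_sym : closed [set A : 'M[R]_n | is_sym_mx A].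
Proof.
rewrite (_ : mkset _ = [set A | A^T - A = 0]).
  apply: closed_mx_eq0; apply: continuous_subr_entry => i j; last exact: coord_continuous.
  rewrite (_ : (fun x => _) = fun x : 'M[R]_n => x j i); first exact: coord_continuous.
  by apply/funext => x; rewrite mxE.
by apply/seteqP; split=> A /= => [->|/subr0_eq]; rewrite ?subrr.
Qed.

Lemma sym_limit (A : nat -> 'M[R]_n) A0 : (forall k, is_sym_mx (A k)) ->
  A @ \oo --> A0 -> is_sym_mx A0.
Proof. by move=> sA; apply: (closed_cvg _ closed_sym); exact: nearW. Qed.

Lemma sym_increment A c W : c != 0 -> is_sym_mx A -> is_sym_mx (A + c *: W) ->
  is_sym_mx W.
Proof.
move=> c0 sA; rewrite /is_sym_mx linearD/= sA linearZ/= => /addrI.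
exact: scalerI.
Qed.

Lemma tangent_cone_sym X H : is_sym_mx X ->
  tangent_cone (spectral_set Theta) X H -> is_sym_mx H.
Proof.
move=> sX [t [Hk [t0 _ HkH C]]]; apply: sym_limit HkH => k.
by apply: (sym_increment _ sX (proj1 (C k))); rewrite gt_eqF.
Qed.

Lemma half_sqr_gt0 (t : R) : 0 < t -> 0 < 2^-1 * t ^+ 2.
Proof. by move=> t0; rewrite mulr_gt0// exprn_gt0. Qed.

Lemma sym_line X H (t : R) : is_sym_mx X -> is_sym_mx H -> is_sym_mx (X + t *: H).
Proof. by move=> sX sH; rewrite /is_sym_mx linearD linearZ/= sX sH. Qed.

Lemma second_tangent_seq_sym X H (t : nat -> R) (Wk : nat -> 'M[R]_n) :
  is_sym_mx X -> is_sym_mx H -> (forall k, 0 < t k) ->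
  (forall k, spectral_set Theta (X + t k *: H + (2^-1 * t k ^+ 2) *: Wk k)) ->
  forall k, is_sym_mx (Wk k).
Proof.
move=> sX sH t0 C k; apply: (sym_increment _ (sym_line (t k) sX sH) (proj1 (C k))).
by rewrite gt_eqF// half_sqr_gt0.
Qed.

(** The Lipschitz bound is proportional to [c], which cancels; a varying direction can thus be
    replaced by its limit in second-order quotients. *)
Lemma eigval_quotient_lipschitz X (c : R) W W' : 0 < c ->
  is_sym_mx X -> is_sym_mx W -> is_sym_mx W' ->
  `|c^-1 *: (eigval (X + c *: W) - eigval (X + c *: W'))| <= n%:R * `|W - W'|.
Proof.
move=> c0 sX sW sW'; rewrite normrZ gtr0_norm ?invr_gt0// mulrC ler_pdivrMr//.
rewrite (le_trans (eigval_lipschitz (sym_line c sX sW) (sym_line c sX sW')))//.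
rewrite opprD addrACA subrr add0r -scalerBr normrZ gtr0_norm// -mulrA.
by rewrite (mulrC c).
Qed.

(** Replacing the spectrum of [A] by a prescribed one amounts to perturbing [W] by the discrepancy
    between [u] and the actual second-order quotient, placed in the eigenbasis of [A]. The
    perturbation is small when these two are close. *)
Lemma with_eigvals_correction X H W d u (t c : R) : c != 0 ->
  is_sym_mx X -> is_sym_mx H -> is_sym_mx W ->
  let A := X + t *: H + c *: W in
  X + t *: H + c *: (W + with_eigvals A (u - c^-1 *: (eigval A - eigval X - t *: d)))
  = with_eigvals A (eigval X + t *: d + c *: u).
Proof.
move=> c0 sX sH sW A; have sA : is_sym_mx A by exact: sym_path.
rewrite scalerDr addrA -/A -{1}(with_eigvals_eigval sA) -with_eigvalsZ -with_eigvalsD.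
rewrite scalerBr scalerA mulfV// scale1r; congr with_eigvals.
move: (eigval A) (eigval X) => a b; apply/rowP => i; rewrite !mxE; ring.
Qed.

(** Both inclusions keep the sequence [t]: one takes eigenvalues of the matrices, the other corrects
    their spectra by [with_eigvals]. *)
Lemma second_tangent_spectral X H : is_sym_mx X -> is_sym_mx H ->
  second_tangent_set (spectral_set Theta) X H =
  (fun W => is_sym_mx W /\
     second_tangent_set Theta (eigval X) (eigval_d1 X H) (eigval_d2 X H W)).
Proof.
move=> sX sH; apply/funext => W; apply/propext; split.
  move=> [t [Wk [t0 tc WkW C]]]; have sWk := second_tangent_seq_sym sX sH t0 C.
  have sW := sym_limit sWk WkW; split => //.
  pose s k := 2^-1 * t k ^+ 2; have s0 k : 0 < s k by exact: half_sqr_gt0.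
  pose E k W' := (s k)^-1 *:
    (eigval (X + t k *: H + s k *: W') - eigval X - t k *: eigval_d1 X H).
  have gc : (fun k => E k W) @ \oo --> eigval_d2 X H W.
    exact: cvg_at_right_seq t0 tc (eigval_d2_cvg sX sH sW).
  exists t, (fun k => E k (Wk k)); split; [exact: t0|exact: tc| |move=> k]; last first.
    rewrite -/(s k) scalerA mulfV ?gt_eqF ?s0// scale1r; case: (C k) => _.
    rewrite -/(s k); congr Theta.
    move: (eigval (_ + _ + _)) (eigval X) (eigval_d1 X H) => a b d.
    by apply/rowP => i; rewrite !mxE; ring.
  (* The quotient at [Wk k] is the quotient at the fixed [W], whose limit is known, plus an error
     controlled by the distance from [Wk k] to [W]. *)
  have -> : (fun k => E k (Wk k)) = fun k => E k W +
     (s k)^-1 *: (eigval (X + t k *: H + s k *: Wk k)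
                 - eigval (X + t k *: H + s k *: W)).
    apply/funext => k; rewrite /E -scalerDr; congr (_ *: _).
    move: (eigval (_ + s k *: Wk k)) (eigval (_ + s k *: W)) (eigval X) => a b c.
    by move: (t k *: _) => d; apply/rowP => i; rewrite !mxE; ring.
  rewrite -[X in _ --> X]addr0; apply: cvgD; first exact: gc.
  apply: (@cvg_linear_norm _ _ _ 'M[R]_n 'rV[R]_n _ _ _ _ n%:R _ _ WkW).
  exists 0%N => // k _ /=; rewrite subr0.
  exact: (eigval_quotient_lipschitz (s0 k) (sym_line (t k) sX sH)).
move=> [sW [t [u [t0 tc uc T]]]].
pose s k := 2^-1 * t k ^+ 2; have s0 k : 0 < s k by exact: half_sqr_gt0.
pose A k := X + t k *: H + s k *: W.
pose g k := (s k)^-1 *: (eigval (A k) - eigval X - t k *: eigval_d1 X H).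
have gc : g @ \oo --> eigval_d2 X H W.
  exact: cvg_at_right_seq t0 tc (eigval_d2_cvg sX sH sW).
exists t, (fun k => W + with_eigvals (A k) (u k - g k)).
split; [exact: t0|exact: tc| |move=> k]; last first.
  rewrite with_eigvals_correction ?gt_eqF//; last exact: s0.
  by apply: spectral_set_with_eigvals => //; exact: sym_path.
have ugc : (fun k => u k - g k) @ \oo --> (0 : 'rV[R]_n).
  by rewrite -(subrr (eigval_d2 X H W)); exact: cvgB.
apply: (@cvg_linear_norm _ _ _ 'rV[R]_n 'M[R]_n _ _ _ _ (n%:R ^+ 2) _ _ ugc).
exists 0%N => // k _ /=.
by rewrite addrC addKr subr0 with_eigvals_norm//; exact: sym_path.
Qed.

End SpectralSets.

(** * Parabolic derivability *)

Section ParabolicDerivability.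
Variables (R : realType) (n : nat) (Theta : set 'rV[R]_n).
Hypothesis symTheta : perm_symmetric Theta.
Implicit Types (A X H W Y : 'M[R]_n) (u v w z : 'rV[R]_n).

(** For nonemptiness, bounded second-order quotients suffice: a subsequence converges. *)
Lemma second_tangent_bounded m p (C : set 'M[R]_(m, p)) (x w : 'M[R]_(m, p))
    (t : nat -> R) (u : nat -> 'M[R]_(m, p)) (M : R) :
  (forall k, 0 < t k) -> t @ \oo --> (0 : R) -> (forall k, `|u k| <= M) ->
  (forall k, C (x + t k *: w + (2^-1 * t k ^+ 2) *: u k)) ->
  second_tangent_set C x w !=set0.
Proof.
move=> t0 tc uM Cu; have [phi [l [hphi ul]]] := bounded_mx_subsequence uM.
exists l, (fun k => t (phi k)), (fun k => u (phi k)); split.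
- by move=> k; exact: t0.
- exact: cvg_subsequence hphi tc.
- exact: ul.
- by move=> k; exact: Cu.
Qed.

Lemma sym0 : is_sym_mx (0 : 'M[R]_n).
Proof. exact: trmx0. Qed.

(** The spectra of [X + t H] are corrected, with [W = 0]. The discrepancies [uk k - g k] need not
    tend to 0, but they are bounded as differences of convergent sequences. *)
Lemma spectral_second_tangent_nonempty X H : is_sym_mx X -> is_sym_mx H ->
  second_tangent_set Theta (eigval X) (eigval_d1 X H) !=set0 ->
  second_tangent_set (spectral_set Theta) X H !=set0.
Proof.
move=> sX sH [u [t [uk [t0 tc uc T]]]].
pose s k := 2^-1 * t k ^+ 2; have s0 k : 0 < s k by exact: half_sqr_gt0.
pose A k := X + t k *: H + s k *: 0.
have sA k : is_sym_mx (A k) by exact: sym_path sX sH sym0.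
pose g k := (s k)^-1 *: (eigval (A k) - eigval X - t k *: eigval_d1 X H).
have gc : g @ \oo --> eigval_d2 X H 0.
  exact: cvg_at_right_seq t0 tc (eigval_d2_cvg sX sH sym0).
have [M1 hM1] := cvg_seq_norm_bounded uc.
have [M2 hM2] := cvg_seq_norm_bounded gc.
apply: (@second_tangent_bounded _ _ _ _ _ t
  (fun k => 0 + with_eigvals (A k) (uk k - g k)) (n%:R ^+ 2 * (M1 + M2))).
- exact: t0.
- exact: tc.
- move=> k; rewrite add0r (le_trans (with_eigvals_norm _ (sA k)))// ler_wpM2l//.
  by rewrite (le_trans (ler_normB _ _))// lerD.
move=> k; rewrite with_eigvals_correction ?gt_eqF//; last 2 first.
  exact: s0.
  exact: sym0.
by apply: spectral_set_with_eigvals => //; exact: sA.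
Qed.

(** The arc [Xi] gives the path [A] the spectrum [xi t]. Its second quotient differs from [W] by
    [p t - g t] placed in an eigenbasis, and [p], [g] share the limit [eigval_d2 X H W]. *)
Lemma spectral_parabolically_derivable X H : is_sym_mx X -> is_sym_mx H ->
  parabolically_derivable Theta (eigval X) (eigval_d1 X H) ->
  parabolically_derivable (spectral_set Theta) X H.
Proof.
move=> sX sH [T0 TD]; split; first exact: spectral_second_tangent_nonempty.
move=> W; rewrite (second_tangent_spectral symTheta sX sH) => -[sW /TD].
move=> [eps [xi [eps0 xiT xi0 _ xi2]]].
pose s (t : R) := 2^-1 * t ^+ 2.
pose A t := X + t *: H + s t *: W.
have sA t : is_sym_mx (A t) by exact: sym_path sX sH sW.
pose Xi t := with_eigvals (A t) (xi t).
have A0 : A 0 = X by rewrite /A /s expr0n/= mulr0 !scale0r !addr0.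
have Xi0 : Xi 0 = X by rewrite /Xi xi0 A0 with_eigvals_eigval.
pose p t := (s t)^-1 *: (xi t - xi 0 - t *: eigval_d1 X H).
pose g t := (s t)^-1 *: (eigval (A t) - eigval X - t *: eigval_d1 X H).
have gc : g @ 0^'+ --> eigval_d2 X H W by exact: eigval_d2_cvg sX sH sW.
have pgc : (fun t => p t - g t) @ 0^'+ --> (0 : 'rV[R]_n).
  by rewrite -(subrr (eigval_d2 X H W)); apply: cvgB; [exact: xi2|exact: gc].
have Xi2 : (fun t => (s t)^-1 *: (Xi t - Xi 0 - t *: H)) @ 0^'+ --> W.
  apply: (@cvg_linear_norm _ _ _ 'rV[R]_n 'M[R]_n _ _ _ _ (n%:R ^+ 2) _ _ pgc).
  near=> t; have t0 : 0 < t by near: t; exact: nbhs_right_gt.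
  have s0 : 0 < s t by exact: half_sqr_gt0.
  have sn0 : s t != 0 by rewrite gt_eqF.
  have XiE : Xi t = X + t *: H + s t *: (W + with_eigvals (A t) (p t - g t)).
    rewrite with_eigvals_correction//; congr with_eigvals.
    rewrite /p xi0 scalerA mulfV// scale1r.
    by move: (xi t) (eigval X) (t *: _) => a b d; apply/rowP => i; rewrite !mxE; ring.
  rewrite subr0 (_ : _ - W = with_eigvals (A t) (p t - g t)).
    exact: with_eigvals_norm (sA t).
  rewrite XiE Xi0; move: (with_eigvals _ _) => B.
  have -> : X + t *: H + s t *: (W + B) - X - t *: H = s t *: (W + B) by mx_lin.
  by rewrite scalerA mulVf// scale1r addrC addKr.
exists eps, Xi; split.
- exact: eps0.
- by move=> t /xiT; exact: spectral_set_with_eigvals.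
- exact: Xi0.
- exact: second_quotient_first Xi2.
- exact: Xi2.
Unshelve. all: by end_near. Qed.

(** The spectrum of [with_eigvals X z] is [z] after sorting; the inverse of the sorting permutation,
    which does not increase norms, is applied to both spectra. *)
Lemma eigval_unsorted_lipschitz X Y z : is_sym_mx X -> is_sym_mx Y ->
  exists s : 'S_n, `|col_perm s (eigval Y) - z| <= n%:R * `|Y - with_eigvals X z|.
Proof.
move=> sX sY; have [s zE] := eigval_with_eigvals z sX.
exists s^-1%g; rewrite -{1}(col_permK z s) -zE -linearB/=.
apply: le_trans (col_perm_norm _ _) _.
exact: eigval_lipschitz (with_eigvals_sym _ _).
Qed.

Lemma tangent_cone_with_eigvals X v : is_sym_mx X ->
  tangent_cone Theta (eigval X) v ->
  tangent_cone (spectral_set Theta) X (with_eigvals X v).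
Proof.
move=> sX [t [vk [t0 tc vc T]]]; exists t, (fun k => with_eigvals X (vk k)).
split; [exact: t0|exact: tc| |move=> k].
  apply: (@cvg_linear_norm _ _ _ 'rV[R]_n 'M[R]_n _ _ _ _ (n%:R ^+ 2) _ _ vc).
  by exists 0%N => // k _ /=; rewrite -with_eigvalsB with_eigvals_norm.
rewrite -{1}(with_eigvals_eigval sX) -with_eigvalsZ -with_eigvalsD.
exact: spectral_set_with_eigvals.
Qed.

Lemma with_eigvals_path X v u (t c : R) : is_sym_mx X ->
  X + t *: with_eigvals X v + c *: with_eigvals X u =
  with_eigvals X (eigval X + t *: v + c *: u).
Proof.
by move=> sX; rewrite !with_eigvalsD !with_eigvalsZ with_eigvals_eigval.
Qed.

Lemma second_tangent_with_eigvals X v u : is_sym_mx X ->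
  second_tangent_set Theta (eigval X) v u ->
  second_tangent_set (spectral_set Theta) X (with_eigvals X v) (with_eigvals X u).
Proof.
move=> sX [t [uk [t0 tc uc T]]]; exists t, (fun k => with_eigvals X (uk k)).
split; [exact: t0|exact: tc| |move=> k].
  apply: (@cvg_linear_norm _ _ _ 'rV[R]_n 'M[R]_n _ _ _ _ (n%:R ^+ 2) _ _ uc).
  by exists 0%N => // k _ /=; rewrite -with_eigvalsB with_eigvals_norm.
by rewrite with_eigvals_path//; exact: spectral_set_with_eigvals.
Qed.

(** The spectrum of [Y k], unsorted by a permutation depending on [k], lies within a constant times
    [s k] of [eigval X + t k *: v], so its second-order quotients are bounded. *)
Lemma second_tangent_eigvals_nonempty X v : is_sym_mx X ->
  second_tangent_set (spectral_set Theta) X (with_eigvals X v) !=set0 ->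
  second_tangent_set Theta (eigval X) v !=set0.
Proof.
move=> sX [W [t [Wk [t0 tc Wc C]]]].
have [M hM] := cvg_seq_norm_bounded Wc.
pose s k := 2^-1 * t k ^+ 2; have s0 k : 0 < s k by exact: half_sqr_gt0.
pose Y k := X + t k *: with_eigvals X v + s k *: Wk k.
have sY k : is_sym_mx (Y k) by case: (C k).
have [pi hpi] := choice (fun k =>
  eigval_unsorted_lipschitz (eigval X + t k *: v) sX (sY k)).
pose z k := eigval X + t k *: v.
apply: (@second_tangent_bounded _ _ _ _ _ t
  (fun k => (s k)^-1 *: (col_perm (pi k) (eigval (Y k)) - z k)) (n%:R * M)).
- exact: t0.
- exact: tc.
- move=> k; rewrite normrZ gtr0_norm ?invr_gt0// mulrC ler_pdivrMr//.
  apply: le_trans (hpi k) _; rewrite -mulrA ler_wpM2l//.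
  rewrite with_eigvalsD with_eigvalsZ with_eigvals_eigval// /Y addrC addKr.
  by rewrite normrZ gtr0_norm// mulrC ler_wpM2r// ltW.
move=> k; rewrite -/(s k) scalerA mulfV ?gt_eqF ?s0// scale1r addrC subrK.
by case: (C k) => _ /(symTheta (pi k)).
Qed.

(** The arc [eta] is the spectrum of [xi], unsorted for each [t] to be near [z t]. The permutation
    may jump with [t]: only the distance from [eta t] to [z t] matters. *)
Lemma eigvals_parabolically_derivable X v : is_sym_mx X ->
  parabolically_derivable (spectral_set Theta) X (with_eigvals X v) ->
  parabolically_derivable Theta (eigval X) v.
Proof.
move=> sX [C0 CD]; split; first exact: second_tangent_eigvals_nonempty.
move=> u /(second_tangent_with_eigvals sX)/CD[eps [xi [eps0 xiC xi0 _ xi2]]].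
pose s (t : R) := 2^-1 * t ^+ 2.
pose z t := eigval X + t *: v + s t *: u.
(* Symmetry of [xi t] is known only on [[0, eps]], while [choice] needs a permutation for every
   [t]. *)
have hpi t : exists pi : 'S_n, is_sym_mx (xi t) ->
    `|col_perm pi (eigval (xi t)) - z t| <= n%:R * `|xi t - with_eigvals X (z t)|.
  have [sY|nY] := pselect (is_sym_mx (xi t)); last by exists 1%g.
  by have [pi h] := eigval_unsorted_lipschitz (z t) sX sY; exists pi.
have [pi {}hpi] := choice hpi.
pose eta t := col_perm (pi t) (eigval (xi t)).
(* The permutation at 0 is an arbitrary choice, but the bound there is 0 and forces equality. *)
have eta0 : eta 0 = eigval X.
  have z0 : z 0 = eigval X by rewrite /z /s expr0n/= mulr0 !scale0r !addr0.
  have := hpi 0; rewrite xi0 z0 with_eigvals_eigval// subrr normr0 mulr0.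
  by move=> /(_ sX); rewrite normr_le0 subr_eq0 /eta xi0 => /eqP.
have eta2 : (fun t => (s t)^-1 *: (eta t - eta 0 - t *: v)) @ 0^'+ --> u.
  apply: (@cvg_linear_norm _ _ _ 'M[R]_n 'rV[R]_n _ _ _ _ n%:R _ _ xi2).
  near=> t; have t0 : 0 < t by near: t; exact: nbhs_right_gt.
  have s0 : 0 < s t by exact: half_sqr_gt0.
  have sn0 : s t != 0 by rewrite gt_eqF.
  have xit : is_sym_mx (xi t).
    apply: proj1 (xiC t _); rewrite (ltW t0)/=.
    by near: t; exact: nbhs_right_le.
  have := hpi t xit; rewrite -/(eta t) -/(s t) -with_eigvals_path// => h.
  rewrite -(ler_pM2l s0) (mulrCA (s t)) !(mulr_normrZ _ s0) !scalerBr.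
  rewrite !scalerA mulfV// !mul1r !scale1r eta0 xi0.
  move: h; rewrite /z !opprD !addrA; apply.
exists eps, eta; split.
- exact: eps0.
- by move=> t /xiC[_ /(symTheta (pi t))].
- exact: eta0.
- exact: second_quotient_first eta2.
- exact: eta2.
Unshelve. all: by end_near. Qed.
End ParabolicDerivability.

Theorem theorem4p3 (R : realType) (n : nat) (Theta : set 'rV[R]_n)
  (X H : 'M[R]_n) :
  perm_symmetric Theta ->
  spectral_set Theta X ->
  tangent_cone (spectral_set Theta) X H ->
  [/\ second_tangent_set (spectral_set Theta) X H =
        (fun W : 'M[R]_n => is_sym_mx W /\
           second_tangent_set Theta (eigval X) (eigval_d1 X H) (eigval_d2 X H W)),
      (parabolically_derivable Theta (eigval X) (eigval_d1 X H) ->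
       parabolically_derivable (spectral_set Theta) X H) &
      ((forall H', tangent_cone (spectral_set Theta) X H' ->
          parabolically_derivable (spectral_set Theta) X H') ->
       forall v, tangent_cone Theta (eigval X) v ->
          parabolically_derivable Theta (eigval X) v)].
Proof.
move=> symTheta [sX TX] TH; have sH := tangent_cone_sym sX TH; split.
- exact: second_tangent_spectral.
- exact: spectral_parabolically_derivable.
- move=> CD v Tv; apply: eigvals_parabolically_derivable => //.
  by apply: CD; exact: tangent_cone_with_eigvals.
Qed.
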